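(* Let $P$ be a weakly non-null kernel on $A$, i.e. $\sum_{a\in A}\inf_{\underline z}P(a|\underline z)>0$, and suppose $\{\mathcal I(\underline a)\}_{\underline a\in A^{-\mathbb N}}$ is a set of range partitions for $P$ for which $\Theta'[0]\ne\emptyset$ $\mathbb P$-a.s. Let $\mathbf X$ be the stationary chain compatible with $P$ and $\mathbf X^{[k]}$ its canonical $k$-steps Markov approximation. Then, for any random time $\theta[0]$ with $\theta[0]\in\Theta'[0]$ and every $k$, $$\bar d(\mathbf X,\mathbf X^{[k]})\le\mathbb P(\theta[0]<-k).$$
   Context: Alphabet and pasts. $A=\{1,\dots,N\}$ with $N\in\{1,2,\dots\}\cup\{\infty\}$ ($A=\{1,2,\dots\}$ if $N=\infty$). $A^{-\mathbb N}$ is the set of pasts $\underline a=\ldots a_{-2}a_{-1}$; $a_{-k}^{-1}=a_{-k}\ldots a_{-1}$ (empty string if $k=0$). Concatenation is written in temporal order. Kernels, chains. A kernel is a (measurable) function $P:A\times A^{-\mathbb N}\to[0,1]$ with $\sum_{a\in A}P(a|\underline x)=1$ for all $\underline x$. A stationary chain $\mathbf X=(X_n)_{n\in\mathbb Z}$ with law $\mu$ on $A^{\mathbb Z}$ is compatible with $P$ if $\mu(X_0=a|X_{-\infty}^{-1}=\underline x)=P(a|\underline x)$ for all $a$ and $\mu$-a.e. $\underline x$. The canonical $k$-steps Markov approximation $\mathbf X^{[k]}$ ($k\ge0$) is the stationary $k$-step Markov chain (i.i.d. if $k=0$) compatible with $P^{[k]}(a|x_{-k}^{-1})=\mu(X_0=a|X_{-k}^{-1}=x_{-k}^{-1})$,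 with $(X^{[k]}_1,\dots,X^{[k]}_k)$ distributed as $(X_1,\dots,X_k)$. For stationary chains, $\bar d(\mathbf X,\mathbf Y)=\inf\mathbb P(\bar X_0\ne\bar Y_0)$, infimum over all couplings $(\bar{\mathbf X},\bar{\mathbf Y})$ of $\mathbf X$ and $\mathbf Y$. Range partitions. A set of range partitions for $P$ is a family $\{\mathcal I(\underline a)\}_{\underline a}$, where $\mathcal I(\underline a)=\{I_k(a|a_{-k}^{-1})\}_{k\in\{0,1,2,\dots\}\cup\{\infty\},\,a\in A}$ is a partition of $[0,1[$ into (possibly empty) intervals, closed on the left and open on the right, such that: (1) the length $|I_k(a|a_{-k}^{-1})|$ depends only on $k$, $a$ and $a_{-k}^{-1}$ (on $a$ and $\underline a$ if $k=\infty$); (2) $\sum_{k\in\{0,1,\dots\}\cup\{\infty\}}|I_k(a|a_{-k}^{-1})|=P(a|\underline a)$ for all $a,\underline a$; (3) the intervals are placed consecutively from left to right in the order $I_0(1|\emptyset),I_0(2|\emptyset),\dots,I_1(1|a_{-1}),I_1(2|a_{-1}),\dots,I_2(1|a_{-2}^{-1}),\dots$, and finally $I_\infty(1|\underline a),I_\infty(2|\underline a),\dots$. Coupling from the past. $(U_n)_{n\in\mathbb Z}$ are i.i.d. uniform on $[0,1[$, with probability $\mathbb P$. Define $F(\underline a,u)=a$ and $L(\underline a,u)=k$ if $u\in I_k(a|a_{-k}^{-1})$ (so $L$ takes values in $\{0,1,\dots\}\cup\{\infty\}$). For $m\le n$ define strings recursively by $F_{\{m,m\}}(\underline a,U_m)=F(\underline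 a,U_m)$ and $F_{\{m,n\}}(\underline a,U_m^n)=F_{\{m,n-1\}}(\underline a,U_m^{n-1})\,F(\underline aF_{\{m,n-1\}}(\underline a,U_m^{n-1}),U_n)$; by convention $F_{\{m,m-1\}}=\emptyset$. Define $$\Theta'[0]=\{i\le0:\ \text{for every }\underline a\in A^{-\mathbb N},\ L(\underline aF_{\{i,j-1\}}(\underline a,U_i^{j-1}),U_j)\le j-i,\ j=i,\dots,0\}.$$ *)

(* Defs.v *)
From HB Require Import structures.
From mathcomp Require Import all_boot all_order all_algebra.
From mathcomp Require Import all_classical all_reals all_analysis.

Set Implicit Arguments.
Unset Strict Implicit.
Unset Printing Implicit Defensive.

Import Order.TTheory GRing.Theory Num.Theory.
Import numFieldNormedType.Exports.

Local Open Scope classical_set_scope.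
Local Open Scope ring_scope.

(* [Some n] is the alphabet {1, ..., n} and [None] the alphabet {1, 2, ...}.
   To have a pointed type for all N, [Some 0] is read as [Some 1]; statements
   should assume [N <> Some 0]. *)
Definition in_alphabet (N : option nat) (a : nat) : bool :=
  (0 < a)%N && (if N is Some n then a <= n.-1.+1 else true)%N.

Record alphabet (N : option nat) : Type :=
  Letter { letter_val : nat; _ : in_alphabet N letter_val }.

Lemma in_alphabet1 (N : option nat) : in_alphabet N 1.
Proof. by case: N. Qed.

HB.instance Definition _ (N : option nat) := [isSub for @letter_val N].
HB.instance Definition _ (N : option nat) := [Countable of alphabet N by <:].
HB.instance Definition _ (N : option nat) :=
  isPointed.Build (alphabet N) (Letter (in_alphabet1 N)).

(* The one-coordinate cylinders generate the product of the discrete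
   sigma-algebras, the alphabet being countable. *)
Definition cylinders (T : Type) (N : option nat) : set (set (T -> alphabet N)) :=
  [set C | exists t a, C = [set x | x t = a]].

(* Pasts are indexed backwards: [x n] stands for x_{-(n+1)}. *)
Definition past (N : option nat) := g_sigma_algebraType (@cylinders nat N).
Definition path_space (N : option nat) := g_sigma_algebraType (@cylinders int N).

Section chains.
Context {R : realType} {N : option nat}.
Local Notation A := (alphabet N).
Local Notation past := (past N).
Local Notation path_space := (path_space N).

Definition push (x : past) (a : A) : past :=
  fun n => if n is m.+1 then x m else a.

(* x w, the word w = w_1 ... w_m being read in temporal order *)
Definition append (x : past) (w : seq A) : past := foldl push x w.

Definition agree (k : nat) (x y : past) : Prop :=
  forall i, (i < k)%N -> x i = y i.

Definition is_kernel (P : A -> past -> R) : Prop :=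
  [/\ forall a, measurable_fun [set: past] (P a),
      forall a x, 0 <= P a x <= 1 &
      forall x, (\esum_(a in [set: A]) (P a x)%:E = 1)%E].

Definition weakly_non_null (P : A -> past -> R) : Prop :=
  (0 < \esum_(a in [set: A]) (inf [set P a z | z in [set: past]])%:E)%E.

Definition shift (x : path_space) : path_space := fun n => x (n + 1).

Definition past_of (x : path_space) : past := fun n => x (- n.+1%:Z).

Definition stationary (mu : probability path_space R) : Prop :=
  forall B, measurable B -> mu (shift @^-1` B) = mu B.

(* [P a (past_of x)] is a version of mu(X_0 = a | X_{-oo}^{-1} = past_of x) *)
Definition compatible (mu : probability path_space R) (P : A -> past -> R) :
    Prop :=
  forall a (B : set past), measurable B ->
    (mu ([set x : path_space | x 0%R = a] `&` past_of @^-1` B) =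
     \int[mu]_(x in past_of @^-1` B) (P a (past_of x))%:E)%E.

(* mu(X_0 = a | X_{-k}^{-1} = x_{-k}^{-1}), with value 0 when the
   conditioning event is null *)
Definition markov_kernel (mu : probability path_space R) (k : nat)
    (a : A) (x : past) : R :=
  fine (mu [set y : path_space | y 0 = a /\ agree k (past_of y) x]) /
  fine (mu [set y : path_space | agree k (past_of y) x]).

(* The equality of the k-dimensional marginals makes the words on which
   [markov_kernel mu k] takes its default value null for nu. *)
Definition canonical_markov_approx (mu : probability path_space R) (k : nat)
    (nu : probability path_space R) : Prop :=
  [/\ stationary nu,
      compatible nu (markov_kernel mu k) &
      forall w : nat -> A,
        nu [set y : path_space | forall i, (i < k)%N -> y i.+1%:Z = w i] =
        mu [set y : path_space | forall i, (i < k)%N -> y i.+1%:Z = w i]].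

(* Couplings of stationary chains are required to be jointly stationary, as
   usual for the d-bar distance: over all joint laws the infimum below would
   only be the total variation distance between the laws of X_0 and Y_0, hence
   0 for a chain and its Markov approximations. *)
Definition coupling (mu nu : probability path_space R)
    (g : probability (path_space * path_space)%type R) : Prop :=
  [/\ forall B, measurable B -> g (fst @^-1` B) = mu B,
      forall B, measurable B -> g (snd @^-1` B) = nu B &
      forall B, measurable B ->
        g ((fun p => (shift p.1, shift p.2)) @^-1` B) = g B].

Definition dbar (mu nu : probability path_space R) : \bar R :=
  ereal_inf [set e | exists g : probability (path_space * path_space)%type R,
    coupling mu nu g /\
    e = g [set p : path_space * path_space | p.1 0 <> p.2 0]].

(* Levels k in {0, 1, ...} u {oo}, with [None] standing for oo. *)
Definition level_lt (k l : option nat) : bool :=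
  match k, l with
  | Some i, Some j => (i < j)%N
  | Some _, None => true
  | None, _ => false
  end.

Definition level_le_int (k : option nat) (z : int) : bool :=
  if k is Some n then n%:Z <= z else false.

Definition index_lt (p q : option nat * A) : bool :=
  level_lt p.1 q.1 || (p.1 == q.1) && (val p.2 < val q.2)%N.

(* [I x k a] is the interval I_k(a | x_{-k}^{-1}) of the partition I(x). *)
Record range_partitions (P : A -> past -> R)
    (I : past -> option nat -> A -> set R) : Prop := {
  rp_interval : forall x k a, exists l r : R, I x k a = `[l, r[%classic;
  rp_cover : forall x,
    \bigcup_(p in [set: option nat * A]) I x p.1 p.2 = `[0, 1[%classic;
  rp_disjoint : forall x,
    trivIset [set: option nat * A] (fun p => I x p.1 p.2) ;
  rp_length : forall (k : nat) a x y, agree k x y ->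
    lebesgue_measure (I x (Some k) a) = lebesgue_measure (I y (Some k) a) ;
  rp_sum : forall a x,
    (\esum_(k in [set: option nat]) lebesgue_measure (I x k a)
     = (P a x)%:E)%E ;
  rp_order : forall x p q s t, index_lt p q ->
    I x p.1 p.2 s -> I x q.1 q.2 t -> s < t
}.

Section coupling_from_the_past.
Variable I : past -> option nat -> A -> set R.

(* the unique (k, a) with u in I_k(a | x_{-k}^{-1}), for 0 <= u < 1 *)
Definition range_index (x : past) (u : R) : option nat * A :=
  xget (None, point) [set p | I x p.1 p.2 u].

Definition L (x : past) (u : R) : option nat := (range_index x u).1.
Definition F (x : past) (u : R) : A := (range_index x u).2.

(* F_{m, m + l - 1}(x, u_m ... u_{m + l - 1}) *)
Fixpoint F_len (m : int) (l : nat) (x : past) (u : int -> R) : seq A :=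
  if l is l'.+1 then
    let s := F_len m l' x u in rcons s (F (append x s) (u (m + l'%:Z)))
  else [::].

Definition F_str (m n : int) (x : past) (u : int -> R) : seq A :=
  if m <= n then F_len m (absz (n - m + 1)) x u else [::].

Definition Theta' (u : int -> R) : set int :=
  [set i | i <= 0 /\ forall (x : past) (j : int), i <= j <= 0 ->
     level_le_int (L (append x (F_str i (j - 1) x u)) (u j)) (j - i)].

End coupling_from_the_past.

End chains.

Definition iid_uniform (R : realType) (d : measure_display)
    (Omega : measurableType d) (Pr : probability Omega R)
    (U : int -> {RV Pr >-> R}) : Prop :=
  (forall n B, measurable B ->
     distribution Pr (U n) B = uniform_prob (@ltr01 R) B) /\
  (forall (s : seq int) (B : int -> set R), uniq s ->
     (forall n, measurable (B n)) ->
     (Pr (\bigcap_(n in [set` s]) (U n @^-1` B n)) =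
      \prod_(n <- s) Pr (U n @^-1` B n))%E).

(* Main.v *)
Require Import Defs.
From HB Require Import structures.
From mathcomp Require Import all_boot all_order all_algebra.
From mathcomp Require Import all_classical all_reals all_analysis.
From mathcomp Require Import measurable_realfun lra ring zify.

(* With the same uniform variables U drive X by the update function F and
   X^[k] by an update function that coincides with F whenever the level is at
   most k and completes it into the k-step kernel on the rest of [0, 1[.
   From an index i of Theta'[0] on, the letter produced at time j only depends
   on those produced at times i, ..., j - 1; if moreover i >= -k, all the levels
   involved are at most k, so both recursions produce the same letters and
   X_0 = X^[k]_0.  Both chains are a.s. limits of the recursion started in the
   remote past: for F because Theta' is a.s. nonempty, at time 0 hence at every
   time, for the k-step chain because it regenerates whenever k + 1 consecutive
   variables fall in the level 0 region, which happens a.s.  Such a limit is a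
   function of U that commutes with shifts, and its law is the only stationary
   law compatible with the kernel, whence a jointly stationary coupling. *)

Set Implicit Arguments.
Unset Strict Implicit.
Unset Printing Implicit Defensive.

Import Order.TTheory GRing.Theory Num.Theory.
Import numFieldNormedType.Exports.

Local Open Scope classical_set_scope.
Local Open Scope ring_scope.

(** * Countable sums and densities *)

(** [F] can be completed into the k-step kernel because the mass that levels up to k give to a
    letter depends only on the last k letters and never exceeds P; averaging over the pasts sharing
    these letters bounds it by the Markov kernel, and the remainder is laid out on the rest of [0,
    1[. This fails on words that X does not charge, where the Markov kernel has a default value;
    X^[k] does not charge them either. For uniqueness, the law of the last n letters is the average,
    over a past drawn from the chain, of the probability that the recursion started j steps earlier
    produces them. It does not depend on j, while coalescence makes the averaged probability tend to
    a limit common to all pasts. Measurability shapes the definitions: [Theta'] quantifies over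
    uncountably many pasts, so a condition testing one past replaces it; Omega need not carry a
    shift, so everything moves to the law of U on sequences. The level 0 region has positive length
    because the first variable used from an index of [Theta'] falls in it. *)

(** [pickle_inv] is [None] off the range of [pickle], so the series over codes meets each element
    exactly once. *)
Lemma esum_countType (R : realType) (V : countType) (D : set V)
    (f : V -> \bar R) : (forall v, D v -> 0 <= f v)%E ->
  (\esum_(v in D) f v =
   \sum_(n <oo) oapp (fun v => if v \in D then f v else 0) 0 (pickle_inv n))%E.
Proof.
move=> f0; pose g n := oapp (fun v => if v \in D then f v else 0%E) 0%E (pickle_inv n).
have g0 n : (0 <= g n)%E.
  rewrite /g; case: pickle_inv => //= v.
  by case: ifPn => // vD; apply: f0; rewrite inE in vD.
rewrite nneseries_esumT//.
have gE v : g (pickle v) = if v \in D then f v else 0%E by rewrite /g pickleK_inv.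
rewrite esum_mkcond.
transitivity (\esum_(v in [set: V]) g (pickle v))%E.
  by apply: eq_esum => v _; rewrite gE.
rewrite -(esum_image [set: V] (@pickle V) g); last first.
  by move=> v w _ _; exact: (pcan_inj pickleK).
rewrite esum_mkcond; apply: eq_esum => n _; case: ifPn => //.
rewrite notin_setE/= => nV; rewrite -/(g n) /g.
case E : (pickle_inv n) => [v|]//=; exfalso; apply: nV.
by exists v => //; have := @pickle_invK V n; rewrite /ocancel E.
Qed.

Lemma measure_bigcup_countType d (T : measurableType d) (R : realType)
    (m : {measure set T -> \bar R}) (V : countType) (D : set V) (F : V -> set T) :
  (forall v, D v -> measurable (F v)) -> trivIset D F ->
  m (\bigcup_(v in D) F v) = (\esum_(v in D) m (F v))%E.
Proof.
move=> mF tF; rewrite esum_countType; last by move=> v _; exact: measure_ge0.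
pose G n := oapp (fun v => if v \in D then F v else set0) set0 (pickle_inv n).
have -> : \bigcup_(v in D) F v = \bigcup_n G n.
  apply/seteqP; split => [t [v Dv Fvt]|t [n _]].
    by exists (pickle v) => //; rewrite /G pickleK_inv/= mem_set.
  rewrite /G; case: pickle_inv => [v|]//=.
  by case: ifPn => // vD Fvt; exists v => //; rewrite inE in vD.
rewrite measure_bigcup//.
- rewrite (eq_eseriesl (Q := xpredT)); last by move=> n; exact: mem_set.
  apply: eq_eseriesr => n _; rewrite /G; case: pickle_inv => [v|]/=; last first.
    by rewrite measure0.
  by case: ifPn; rewrite ?measure0.
- move=> n _; rewrite /G; case: pickle_inv => [v|]//=.
  by case: ifPn => // vD; apply: mF; rewrite inE in vD.
- move=> i j _ _ [t []]; rewrite /G.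
  have := @pickle_invK V i; have := @pickle_invK V j; rewrite /ocancel.
  case: (pickle_inv j) => [w|]//= <-; case: (pickle_inv i) => [v|]//= <-.
  case: ifPn => // vD Fvt; case: ifPn => // wD Fwt.
  congr pickle; apply: (tF v w); [exact: set_mem|exact: set_mem|].
  by exists t.
Qed.

Lemma ge0_integral_esum d (T : measurableType d) (R : realType)
    (m : {measure set T -> \bar R}) (V : countType) (D : set V)
    (f : V -> T -> \bar R) :
  (forall v, D v -> measurable_fun setT (f v)) ->
  (forall v t, D v -> 0 <= f v t)%E ->
  (\int[m]_t (\esum_(v in D) f v t) = \esum_(v in D) \int[m]_t f v t)%E.
Proof.
move=> mf f0; rewrite esum_countType; last first.
  by move=> v Dv; apply: integral_ge0 => t _; exact: f0.
pose g n t := oapp (fun v => if v \in D then f v t else 0%E) 0%E (pickle_inv n).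
transitivity (\int[m]_t (\sum_(n <oo) g n t))%E.
  by apply: eq_integral => t _; rewrite esum_countType// => v; exact: f0.
rewrite integral_nneseries//.
- apply: eq_eseriesr => n _; rewrite /g; case: pickle_inv => [v|]/=; last first.
    by rewrite integral0.
  by case: (v \in D); rewrite ?integral0.
- move=> n; rewrite /g; case: pickle_inv => [v|]//=.
  by case: (boolP (v \in D)) => // vD; apply: mf; exact: set_mem.
- move=> n t _; rewrite /g; case: pickle_inv => [v|]//=.
  by case: ifPn => // vD; apply: f0; rewrite inE in vD.
Qed.

(** * Change of variables with a density *)

Section density.
Import HBNNSimple.

(** The hypothesis on sets says that [m2] is the image under [h] of the measure of density [p] with
    respect to [m1]; simple functions and monotone convergence carry it over to functions. *)
Lemma ge0_integral_density d1 d2 (X : measurableType d1) (Y : measurableType d2)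
    (R : realType) (m1 : {measure set X -> \bar R})
    (m2 : {measure set Y -> \bar R}) (p : X -> R) (h : X -> Y) :
  measurable_fun setT p -> (forall x, 0 <= p x) -> measurable_fun setT h ->
  (forall B, measurable B -> m2 B = \int[m1]_(x in h @^-1` B) (p x)%:E)%E ->
  forall f : Y -> \bar R, measurable_fun setT f -> (forall y, 0 <= f y)%E ->
  (\int[m2]_y f y = \int[m1]_x ((p x)%:E * f (h x)))%E.
Proof.
move=> mp p0 mh m2E f mf f0.
pose f_ := nnsfun_approx measurableT mf.
have f_cvg y : ((f_ n y)%:E @[n --> \oo] --> f y)%E.
  by apply: cvg_nnsfun_approx.
have f_nd y : {homo (fun n => (f_ n y)%:E) : m n / (m <= n)%N >-> (m <= n)%E}.
  by move=> m n mn; rewrite lee_fin; exact/lefP/nd_nnsfun_approx.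
have mhB B : measurable B -> measurable (h @^-1` B).
  by move=> mB; rewrite -[X in measurable X]setTI; exact: mh.
transitivity (limn (fun n => \int[m2]_x (f_ n x)%:E))%E.
  rewrite -monotone_convergence//.
  - by apply: eq_integral => y _; apply/esym/cvg_lim => //; exact: f_cvg.
  - by move=> n; exact/measurable_EFinP/measurable_funP.
  - by move=> n y _; rewrite lee_fin.
transitivity (limn (fun n => \int[m1]_x ((p x)%:E * (f_ n (h x))%:E)))%E; last first.
  rewrite -monotone_convergence//.
  - apply: eq_integral => x _; apply/cvg_lim => //.
    by apply: cvgeZl => //; exact: f_cvg.
  - move=> n; apply: emeasurable_funM; first exact/measurable_EFinP.
    by apply/measurable_EFinP; apply: measurableT_comp => //; exact: measurable_funP.
  - by move=> n y _; rewrite mule_ge0// lee_fin.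
  - by move=> y _ i j ij; rewrite lee_wpmul2l ?lee_fin//; exact/lefP/nd_nnsfun_approx.
congr (limn _); apply/funext => n.
have mfn r : measurable (f_ n @^-1` [set r]) by [].
under eq_integral do rewrite fimfunE -fsumEFin//.
rewrite ge0_integral_fsum//; last 2 first.
- by move=> y; exact/measurable_EFinP/measurable_funM.
- by move=> y x _; rewrite nnfun_muleindic_ge0.
transitivity (\sum_(r \in range (f_ n)) \int[m1]_x
    ((p x)%:E * (r * \1_(f_ n @^-1` [set r]) (h x))%:E))%E; last first.
  rewrite -ge0_integral_fsum//; last 2 first.
  - move=> r; apply: emeasurable_funM; first exact/measurable_EFinP.
    apply/measurable_EFinP; apply: measurable_funM => //.
    have mi : measurable_fun setT (\1_(f_ n @^-1` [set r]) : Y -> R) by [].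
    exact: (measurableT_comp mi mh).
  - by move=> r x _; apply: mule_ge0; [rewrite lee_fin|exact: nnfun_muleindic_ge0].
  apply: eq_integral => x _; rewrite [in RHS]fimfunE -fsumEFin//.
  by rewrite ge0_mule_fsumr// => r; exact: nnfun_muleindic_ge0.
apply: eq_fsbigr => r; rewrite inE => -[y _ fyr].
have r0 : 0 <= r by rewrite -fyr.
rewrite integralZl_indic_nnsfun// integral_indic// setIT m2E//.
have mA := mhB _ (mfn r).
rewrite -ge0_integralZl ?lee_fin//; last 2 first.
- exact/measurable_funTS/measurable_EFinP.
- by move=> x _; rewrite lee_fin.
rewrite integral_mkcond; apply: eq_integral => x _; rewrite patchE indicE.
rewrite [h x \in _](_ : _ = (x \in h @^-1` (f_ n @^-1` [set r]))).
  by case: ifPn; rewrite ?mulr1 ?mulr0 ?mule0// muleC.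
by apply/idP/idP; rewrite !inE.
Qed.

End density.

(** * The law of the driving sequence *)

Section countable_quantifiers.
Context d (T : sigmaRingType d) (V : countType).

Lemma measurable_existsC (P : V -> T -> Prop) :
  (forall v, measurable [set t | P v t]) -> measurable [set t | exists v, P v t].
Proof.
move=> mP; rewrite (_ : [set t | _] = \bigcup_v [set t | P v t]).
  by apply: countable_bigcupT_measurable => //; exact: countableP.
by apply/seteqP; split=> t /= [v]; exists v.
Qed.

End countable_quantifiers.

Lemma measurable_forallC d (T : measurableType d) (V : countType)
    (P : V -> T -> Prop) :
  (forall v, measurable [set t | P v t]) -> measurable [set t | forall v, P v t].
Proof.
move=> mP; rewrite (_ : [set t | _] = ~` [set t | exists v, (~` [set t | P v t]) t]).
  by apply/measurableC/measurable_existsC => v; apply: measurableC; exact: mP.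
by apply/seteqP; split=> t /=; [move=> Pt [v]; exact | move=> /forallNP Pt v; apply: contrapT].
Qed.

Lemma measurable_Prop d (T : measurableType d) (p : Prop) :
  measurable [set t : T | p].
Proof.
have [hp|hp] := pselect p.
  by rewrite (_ : [set t | p] = setT)//; apply/seteqP; split.
by rewrite (_ : [set t | p] = set0)//; apply/seteqP; split.
Qed.

Lemma measurable_impl d (T : measurableType d) (p : Prop) (P : T -> Prop) :
  (p -> measurable [set t | P t]) -> measurable [set t | p -> P t].
Proof.
have [hp mP|hp _] := pselect p.
  rewrite (_ : [set t | _] = [set t | P t]); first exact: mP.
  by apply/seteqP; split=> t /=; [exact|].
by rewrite (_ : [set t | _] = setT)//; apply/seteqP; split=> // t _ /hp.
Qed.

Lemma pushforward_probability d d' (T : measurableType d) (T' : measurableType d')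
    (R : realType) (Pr : probability T R) (f : T -> T') :
  measurable_fun setT f ->
  exists Q : probability T' R, forall B, Q B = Pr (f @^-1` B).
Proof.
move=> mf; pose f_mixin := isMeasurableFun.Build _ _ _ _ _ mf.
pose g : {mfun T >-> T'} := HB.pack f f_mixin.
by exists (distribution Pr g).
Qed.

Section driving_sequence.
Context {R : realType}.

Definition box (s : seq int) (B : int -> set R) : set (int -> R) :=
  [set u | forall n, n \in s -> B n (u n)].

Definition boxes : set (set (int -> R)) :=
  [set C | exists s B, [/\ uniq s, forall n, measurable (B n) & C = box s B]].

(** Sequences with the product sigma-algebra: unlike an arbitrary [Omega], this space is acted on by
    the translations of time. *)
Definition rseq := g_sigma_algebraType boxes.

Lemma measurable_box (s : seq int) (B : int -> set R) : uniq s ->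
  (forall n, measurable (B n)) -> measurable (box s B : set rseq).
Proof. by move=> us mB; apply: sub_sigma_algebra; exists s, B. Qed.

Lemma measurable_coord (n : int) (B : set R) : measurable B ->
  measurable [set u : rseq | B (u n)].
Proof.
move=> mB; rewrite (_ : [set u | _] = box [:: n] (fun=> B)).
  by apply: measurable_box.
by apply/seteqP; split=> u /= Bu; [move=> m; rewrite inE => /eqP ->|apply: Bu; rewrite inE].
Qed.

Lemma setI_closed_boxes : setI_closed boxes.
Proof.
move=> _ _ [s [B [us mB ->]]] [s' [B' [us' mB' ->]]].
exists (undup (s ++ s')),
  (fun n => (if n \in s then B n else setT) `&` (if n \in s' then B' n else setT)).
split; first exact: undup_uniq.
  by move=> n; apply: measurableI; case: ifP.
apply/seteqP; split=> [u [Bu B'u] n _|u Bu].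
  by split; case: ifP => // ns; [exact: Bu|exact: B'u].
split=> n ns.
  by have [] := Bu n; rewrite ?mem_undup ?mem_cat ns// .
by have [] := Bu n; rewrite ?mem_undup ?mem_cat ns ?orbT// .
Qed.

Lemma measurable_to_rseq d (T : measurableType d) (f : T -> rseq) :
  (forall n B, measurable B -> measurable [set t | B (f t n)]) ->
  measurable_fun setT f.
Proof.
move=> mf; apply: (@measurability _ _ _ rseq _ _ boxes) => //.
move=> _ [_ [s [B [us mB ->]]] <-]; rewrite setTI.
rewrite (_ : _ @^-1` _ = [set t | forall n, n \in s -> B n (f t n)])//.
by apply: measurable_forallC => n; apply: measurable_impl => _; exact: mf.
Qed.

Definition translate (t : int) (u : rseq) : rseq := fun n => u (n + t).

Lemma measurable_translate t : measurable_fun setT (translate t).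
Proof.
by apply: measurable_to_rseq => n B mB; exact: (measurable_coord (n + t) mB).
Qed.

Definition iid_law (Q : probability rseq R) := forall s B, uniq s ->
  (forall n, measurable (B n)) ->
  Q (box s B) = (\prod_(n <- s) uniform_prob (@ltr01 R) (B n))%E.

(** A translated box is a box with the same factors, and boxes form a generating pi-system. *)
Lemma iid_law_translate (Q : probability rseq R) t (E : set rseq) : iid_law Q ->
  measurable E -> Q (translate t @^-1` E) = Q E.
Proof.
move=> hQ; have [Q' Q'E] := pushforward_probability Q (measurable_translate t).
move=> mE; rewrite -Q'E.
apply: (@measure_unique _ R (rseq) boxes (fun=> setT) _ _ _ _ Q' Q) => //.
- exact: setI_closed_boxes.
- by move=> _; exists [::], (fun=> setT); split=> //; apply/seteqP; split.
- by apply/seteqP; split=> // x _; exists 0%N.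
- move=> _ [s [B [us mB ->]]].
  transitivity (Q (translate t @^-1` box s B)); first exact: Q'E.
  transitivity (\prod_(n <- s) uniform_prob (@ltr01 R) (B n))%E; last exact/esym/hQ.
  have us' : uniq [seq n + t | n <- s] by rewrite map_inj_uniq//; exact: addIr.
  rewrite (_ : _ @^-1` _ = box [seq n + t | n <- s] (fun n => B (n - t))).
    by rewrite hQ// big_map; apply: eq_bigr => n _; rewrite addrK.
  apply/seteqP; split=> u Bu n.
    by move=> /mapP[m ms ->]; rewrite addrK; exact: Bu.
  by move=> ns; have := Bu (n + t); rewrite addrK; apply; exact: map_f.
- by move=> _; rewrite [ltLHS](_ : _ = 1%E) ?ltry//; exact: probability_setT.
Qed.

Lemma iid_uniform_law d (Omega : measurableType d) (Pr : probability Omega R)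
    (U : int -> {RV Pr >-> R}) : iid_uniform U ->
  measurable_fun setT ((fun w n => U n w) : Omega -> rseq) /\
  exists2 Q : probability rseq R, iid_law Q &
    forall B, Q B = Pr [set w | B (fun n => U n w)].
Proof.
move=> [Udist Uind].
have mU : measurable_fun setT ((fun w n => U n w) : Omega -> rseq).
  apply: measurable_to_rseq => n B mB.
  by rewrite -[X in measurable X]setTI; exact: (measurable_funP (U n)).
split=> //; have [Q QE] := pushforward_probability Pr mU; exists Q => // s B us mB.
rewrite QE -(eq_bigr _ (fun n _ => Udist n (B n) (mB n))) -Uind//.
Qed.

End driving_sequence.
Arguments rseq : clear implicits.

(** * Words generated by an update function *)

Section words.
Context {R : realType} {N : option nat}.
Local Notation A := (alphabet N).
Local Notation past := (past N).
Implicit Types (x y : past) (w s : seq A) (u : rseq R) (m : int) (l k : nat).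

Lemma append_cat x s w : append x (s ++ w) = append (append x s) w.
Proof. exact: foldl_cat. Qed.

Lemma append_rcons x s a : append x (rcons s a) = push (append x s) a.
Proof. exact: foldl_rcons. Qed.

Lemma agreeW k l x y : (k <= l)%N -> agree l x y -> agree k x y.
Proof. by move=> kl xy i ik; apply: xy; exact: leq_trans kl. Qed.

Lemma agree_push k x y a : agree k x y -> agree k.+1 (push x a) (push y a).
Proof. by move=> xy [|i]//= ik; exact: xy. Qed.

Lemma agree_append k x y w :
  agree k x y -> agree (size w + k) (append x w) (append y w).
Proof.
by elim: w k x y => // a w IH k x y xy; rewrite addSnnS; apply: IH; exact: agree_push.
Qed.

Lemma agree_appendT x y w : agree (size w) (append x w) (append y w).
Proof. by rewrite -[size w]addn0; exact: agree_append. Qed.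

Lemma append_lt x w i : (i < size w)%N ->
  append x w i = nth point w (size w - i.+1).
Proof.
elim/last_ind: w i => // w a IH i; rewrite size_rcons append_rcons.
case: i => [_|i iw]/=; first by rewrite subn1/= nth_rcons ltnn eqxx.
by rewrite IH// nth_rcons subSS ifT//; lia.
Qed.

Lemma append_ge x w i : append x w (size w + i)%N = x i.
Proof.
elim/last_ind: w i => // w a IH i; rewrite size_rcons append_rcons addSn/=.
exact: IH.
Qed.

Lemma agree_append_image x w :
  [set append z w | z in [set: past]] = [set y | agree (size w) y (append x w)].
Proof.
apply/seteqP; split=> y /=; first by move=> [z _ <-]; exact: agree_appendT.
move=> yx; exists (fun i => y (size w + i)%N) => //; apply/funext => i.
have [iw|wi] := ltnP i (size w); first by rewrite yx// !append_lt.
by rewrite -{1}(subnKC wi) append_ge subnKC.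
Qed.

Variable G : past -> R -> A.

(** The recursion of [F_len] for an arbitrary update function, so that both chains are treated at
    once. *)
Fixpoint word m l x u : seq A :=
  if l is l'.+1 then
    let s := word m l' x u in rcons s (G (append x s) (u (m + l'%:Z)))
  else [::].

Lemma size_word m l x u : size (word m l x u) = l.
Proof. by elim: l => //= l IH; rewrite size_rcons IH. Qed.

Lemma word_add m l k x u : word m (l + k) x u =
  word m l x u ++ word (m + l%:Z) k (append x (word m l x u)) u.
Proof.
elim: k => [|k IH]; first by rewrite addn0 cats0.
rewrite addnS /= IH append_cat -rcons_cat; congr rcons; congr (G _ (u _)).
by rewrite PoszD addrA.
Qed.

Lemma word_translate m l x u t : word m l x (translate t u) = word (m + t) l x u.
Proof.
by elim: l => //= l ->; rewrite /translate addrAC.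
Qed.

Hypothesis mG : forall x a, measurable [set v | G x v = a].

Lemma measurable_word m l x w : measurable [set u : rseq R | word m l x u = w].
Proof.
elim: l w => [|l IH] w; first exact: (@measurable_Prop _ _ ([::] = w)).
case/lastP: w => [|w a].
  rewrite (_ : [set u | _] = set0)//; apply/seteqP; split=> u //= /(congr1 size).
  by rewrite size_rcons.
rewrite (_ : [set u | _] = [set u | word m l x u = w] `&`
    [set u : rseq R | [set v | G (append x w) v = a] (u (m + l%:Z))]).
  by apply: measurableI; [exact: IH|apply: measurable_coord; exact: mG].
apply/seteqP; split=> u /=; first by move=> /rcons_inj[-> ->].
by move=> [-> ->].
Qed.

Lemma measurable_word_pred m l x (S : set (seq A)) :
  measurable [set u : rseq R | S (word m l x u)].
Proof.
rewrite (_ : [set u | _] = [set u | exists w, S w /\ word m l x u = w]).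
  apply: measurable_existsC => w.
  by apply: measurableI; [exact: measurable_Prop|exact: measurable_word].
by apply/seteqP; split=> u /=; [exists (word m l x u)|move=> [w [Sw ->]]].
Qed.

(** Once the word is prescribed, the past used at each step is known: the recursion unfolds into
    separate constraints, one per coordinate of [u]. *)
Lemma word_take m l x u w : (l <= size w)%N -> word m l x u = take l w <->
  forall i, (i < l)%N -> G (append x (take i w)) (u (m + i%:Z)) = nth point w i.
Proof.
elim: l => [|l IH] lw; first by rewrite take0.
have {}IH := IH (ltnW lw).
rewrite (take_nth point)//=; split=> [/rcons_inj[e]|wE].
  rewrite e => Ga i; rewrite ltnS leq_eqVlt => /predU1P[->//|].
  by move: i; apply/IH.
have -> : word m l x u = take l w.
  by apply/IH => i il; apply: wE; exact: ltnW.
by rewrite wE.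
Qed.

Definition step_prob x a : R := fine (uniform_prob (@ltr01 R) [set v | G x v = a]).

Lemma step_probE x a :
  (step_prob x a)%:E = uniform_prob (@ltr01 R) [set v | G x v = a].
Proof. by rewrite fineK// fin_num_measure//; exact: mG. Qed.

Lemma step_prob_ge0 x a : 0 <= step_prob x a.
Proof. by rewrite -lee_fin step_probE measure_ge0. Qed.

Fixpoint word_prob x w : R :=
  if w is a :: w' then step_prob x a * word_prob (push x a) w' else 1.

Lemma word_prob_ge0 x w : 0 <= word_prob x w.
Proof. by elim: w x => //= a w IH x; rewrite mulr_ge0 ?step_prob_ge0. Qed.

Lemma word_probE x w : word_prob x w =
  \prod_(i <- iota 0 (size w)) step_prob (append x (take i w)) (nth point w i).
Proof.
elim: w x => [|a w IH] x /=; first by rewrite big_nil.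
rewrite big_cons IH; congr (_ * _); rewrite (iotaDl 1 0) big_map.
by apply: eq_bigr => i _; rewrite add1n.
Qed.

(** By [word_take] the event is a box over the times m, ..., m + |w| - 1, so independence factorises
    it. *)
Lemma prob_word (Q : probability (rseq R) R) m x w : iid_law Q ->
  Q [set u | word m (size w) x u = w] = (word_prob x w)%:E.
Proof.
move=> hQ.
(* The distance from [m] to the time [n] recovers the position in [w]. *)
pose B n := [set v | G (append x (take (absz (n - m)%R) w)) v = nth point w (absz (n - m)%R)].
have us : uniq [seq m + i%:Z | i <- iota 0 (size w)].
  by rewrite map_inj_uniq ?iota_uniq// => i j /addrI[].
have mi (i : nat) : absz (m + i%:Z - m)%R = i by rewrite addrAC subrr add0r.
rewrite (_ : [set u | _] = box [seq m + i%:Z | i <- iota 0 (size w)] B).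
  rewrite hQ//; last by move=> n; exact: mG.
  rewrite word_probE big_map -prodEFin; apply: eq_bigr => i _.
  by rewrite step_probE /B mi.
apply/seteqP; split=> u /=.
  rewrite -{2}(take_size w) => /word_take wE _ /mapP[i + ->].
  by rewrite mem_iota /B mi => /andP[_ iw]; exact: wE.
move=> Bu; rewrite -{2}(take_size w); apply/word_take => // i iw.
have := Bu (m + i%:Z); rewrite /B mi; apply; apply: map_f.
by rewrite mem_iota.
Qed.

End words.

(** * Stationary laws driven by an update function *)

Section path_measurability.
Context {R : realType} {N : option nat}.
Local Notation A := (alphabet N).
Local Notation past := (past N).
Local Notation path_space := (path_space N).

Lemma measurable_past_coord n (a : A) : measurable [set x : past | x n = a].
Proof. by apply: sub_sigma_algebra; exists n, a. Qed.

Lemma measurable_path_coord t (a : A) : measurable [set x : path_space | x t = a].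
Proof. by apply: sub_sigma_algebra; exists t, a. Qed.

Lemma measurable_to_past d (T : measurableType d) (f : T -> past) :
  (forall n a, measurable [set t | f t n = a]) -> measurable_fun setT f.
Proof.
move=> mf; apply: (@measurability _ _ _ past _ _ (@cylinders nat N)) => //.
by move=> _ [_ [n [a ->]] <-]; rewrite setTI; exact: mf.
Qed.

Lemma measurable_to_path d (T : measurableType d) (f : T -> path_space) :
  (forall n a, measurable [set t | f t n = a]) -> measurable_fun setT f.
Proof.
move=> mf; apply: (@measurability _ _ _ path_space _ _ (@cylinders int N)) => //.
by move=> _ [_ [n [a ->]] <-]; rewrite setTI; exact: mf.
Qed.

Lemma measurable_past_of : measurable_fun setT (@past_of N).
Proof. by apply: measurable_to_past => n a; exact: measurable_path_coord. Qed.

Lemma measurable_push (a : A) : measurable_fun setT (fun x : past => push x a).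
Proof.
apply: measurable_to_past => -[|n] b; first exact: (@measurable_Prop _ _ (a = b)).
exact: measurable_past_coord.
Qed.

Lemma measurable_agree k (x : past) : measurable [set y : past | agree k y x].
Proof.
apply: measurable_forallC => n; apply: measurable_impl => _.
exact: measurable_past_coord.
Qed.

Lemma push_image a (B : set past) : [set push x a | x in B] =
  [set x : past | x 0%N = a] `&` (fun x n => x n.+1) @^-1` B.
Proof.
apply/seteqP; split=> y /=; first by move=> [x Bx <-]; split.
by move=> [ya By]; exists (fun n => y n.+1) => //; apply/funext => -[|n].
Qed.

Lemma measurable_push_image a (B : set past) : measurable B ->
  measurable [set push x a | x in B].
Proof.
move=> mB; rewrite push_image; apply: measurableI; first exact: measurable_past_coord.
have mpop : measurable_fun setT (fun x : past => (fun n => x n.+1) : past).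
  by apply: measurable_to_past => n b; exact: measurable_past_coord.
by rewrite -[X in measurable X]setTI; exact: mpop.
Qed.

Lemma push_inj a : injective (fun x : past => push x a).
Proof. by move=> x y xy; apply/funext => n; have := congr1 (fun z : past => z n.+1) xy. Qed.

Lemma past_of_shift (y : path_space) : past_of (Defs.shift y) = push (past_of y) (y 0).
Proof.
apply/funext => -[|n]; rewrite /past_of /Defs.shift/=; congr (y _); lia.
Qed.

Variable G : past -> R -> A.
Hypothesis mG : forall x a, measurable [set v | G x v = a].
Hypothesis mstep : forall a, measurable_fun setT (fun x : past => step_prob G x a).

(** Compatibility with the kernel realised by [G]. For the Markov approximation that kernel is
    matched with [markov_kernel] almost everywhere only. *)
Definition driven (mu : probability path_space R) := forall a (B : set past),
  measurable B -> mu ([set x : path_space | x 0 = a] `&` past_of @^-1` B) =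
  (\int[mu]_(x in past_of @^-1` B) (step_prob G (past_of x) a)%:E)%E.

Lemma measurable_word_prob w : measurable_fun setT (fun x : past => word_prob G x w).
Proof.
elim: w => [|a w IH]; first exact: measurable_cst.
by apply: measurable_funM => //; apply: (measurableT_comp IH); exact: measurable_push.
Qed.

Variable mu : probability path_space R.
Hypothesis smu : stationary mu.
Hypothesis dmu : driven mu.

(** After a shift by one, X_0 becomes the last letter of the past; stationarity thus identifies a
    transition to [a] with a past that ends in [a]. *)
Lemma integral_step (a : A) (f : past -> \bar R) :
  measurable_fun setT f -> (forall x, 0 <= f x)%E ->
  (\int[mu]_y ((step_prob G (past_of y) a)%:E * f (push (past_of y) a)) =
   \int[mu]_(y in past_of @^-1` [set x : past | x 0%N = a]) f (past_of y))%E.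
Proof.
move=> mf f0; have [Q QE] := pushforward_probability mu measurable_past_of.
have ma := measurable_past_coord 0 a.
have mpB B : measurable B -> measurable (past_of @^-1` B : set path_space).
  by move=> mB; rewrite -[X in measurable X]setTI; exact: measurable_past_of.
transitivity (\int[mrestr Q ma]_x f x)%E.
  apply/esym/ge0_integral_density => //.
  - exact: (measurableT_comp (mstep a) measurable_past_of).
  - by move=> y; exact: step_prob_ge0.
  - exact: (measurableT_comp (measurable_push a) measurable_past_of).
  move=> B mB.
  transitivity (mu (past_of @^-1` (B `&` [set x : past | x 0%N = a]))); first exact: QE.
  have mB' : measurable ((fun x => push x a) @^-1` B).
    by rewrite -[X in measurable X]setTI; exact: measurable_push.
  rewrite -(dmu a mB') -[LHS]smu; last by apply: mpB; exact: measurableI.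
  congr (mu _); apply/seteqP; split=> y; rewrite /preimage/= past_of_shift/=.
    by move=> [+ y0]; rewrite y0.
  by move=> [-> ?]; split.
rewrite (@ge0_integral_density _ _ path_space past R mu (mrestr Q ma)
   (\1_(past_of @^-1` [set x : past | x 0%N = a])) (@past_of N))//.
- rewrite [RHS]integral_mkcond; apply: eq_integral => y _.
  by rewrite patchE indicE; case: ifPn; rewrite ?mul1e ?mul0e.
- by apply: measurable_indic; exact: mpB.
- exact: measurable_past_of.
- move=> B mB; rewrite integral_indic; [|exact: mpB|exact: mpB].
  transitivity (mu (past_of @^-1` (B `&` [set x : past | x 0%N = a]))); first exact: QE.
  congr (mu _); rewrite setIC.
  by apply/seteqP; split.
Qed.

(** Induction on the word, its first letter being absorbed by [integral_step]. The set [B] is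
    arbitrary because each step replaces it by its image under [push]. *)
Lemma integral_word_prob w (B : set past) : measurable B ->
  (\int[mu]_(y in past_of @^-1` B) (word_prob G (past_of y) w)%:E =
   mu (past_of @^-1` [set append x w | x in B]))%E.
Proof.
have mpB C : measurable C -> measurable (past_of @^-1` C : set path_space).
  by move=> mC; rewrite -[X in measurable X]setTI; exact: measurable_past_of.
elim: w B => [|a w IH] B mB.
  by rewrite /= integral_cst ?mul1e; [rewrite image_id|exact: mpB].
rewrite (_ : [set append x (a :: w) | x in B] =
    [set append z w | z in [set push x a | x in B]]); last first.
  by rewrite image_comp.
rewrite -IH; last exact: measurable_push_image.
pose f x := ((word_prob G x w)%:E * (\1_[set push x a | x in B] x)%:E)%E.
have mf : measurable_fun setT f.
  apply: emeasurable_funM; first by apply/measurable_EFinP; exact: measurable_word_prob.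
  by apply/measurable_EFinP/measurable_indic; exact: measurable_push_image.
have f0 x : (0 <= f x)%E by rewrite mule_ge0// lee_fin//; exact: word_prob_ge0.
transitivity (\int[mu]_y ((step_prob G (past_of y) a)%:E * f (push (past_of y) a)))%E.
  rewrite [LHS]integral_mkcond; apply: eq_integral => y _.
  rewrite patchE /f indicE muleA -EFinM.
  have -> : (push (past_of y) a \in [set push x a | x in B]) = (y \in past_of @^-1` B).
    apply/idP/idP; rewrite !inE/=; last by exists (past_of y).
    by move=> [x Bx /push_inj <-].
  by case: ifPn; rewrite /= ?mulr1 ?mulr0.
rewrite integral_step// integral_mkcond [RHS]integral_mkcond.
apply: eq_integral => y _; rewrite !patchE /f indicE.
have -> : (y \in past_of @^-1` [set push x a | x in B]) =
    (past_of y \in [set push x a | x in B]).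
  by apply/idP/idP; rewrite !inE.
case: ifPn => [_|]; first by case: ifPn; rewrite ?mule1 ?mule0.
rewrite notin_setE/= => ya; rewrite ifF//; apply/negP; rewrite inE => -[x _ xy].
by apply: ya; rewrite -xy.
Qed.

Lemma integral_word_probT w (x : past) :
  (\int[mu]_y (word_prob G (past_of y) w)%:E =
   mu [set y | agree (size w) (past_of y) (append x w)])%E.
Proof.
have := @integral_word_prob w setT measurableT.
by rewrite preimage_setT (agree_append_image x) => ->.
Qed.

End path_measurability.

(** * Countable almost sure statements and bounded convergence *)

Lemma ae_forallC d (T : measurableType d) (R : realType)
    (m : {measure set T -> \bar R}) (V : countType) (P : V -> T -> Prop) :
  (forall v, {ae m, forall t, P v t}) -> {ae m, forall t, forall v, P v t}.
Proof.
move=> aeP; have : {ae m, forall t, forall n,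
    (oapp (fun v => P v t) True (unpickle n))}.
  apply/ae_foralln => n; case: (unpickle n) => [v|]/=; first exact: aeP.
  exact: aeW.
by apply: filterS => t Pt v; have := Pt (pickle v); rewrite pickleK.
Qed.

Lemma cvg_probability_ae d (T : measurableType d) (R : realType)
    (Q : probability T R) (A_ : nat -> set T) (A : set T) :
  (forall j, measurable (A_ j)) -> measurable A ->
  {ae Q, forall t, exists J, forall j, (J <= j)%N -> A_ j t <-> A t} ->
  (Q (A_ j) @[j --> \oo] --> Q A)%E.
Proof.
move=> mA_ mA aeA.
have [|||||_ _] := @dominated_convergence _ T R Q setT measurableT
    (fun j t => (\1_(A_ j) t)%:E) (fun t => (\1_A t)%:E) (cst 1%E).
- by move=> j; apply/measurable_EFinP/measurable_indic.
- by apply/measurable_EFinP/measurable_indic.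
- apply: filterS aeA => t [J AJ] _; apply: cvg_near_cst; exists J => // j Jj.
  by rewrite !indicE; congr ((_ : bool)%:R%:E); apply/idP/idP; rewrite !inE => /AJ; exact.
- exact: finite_measure_integrable_cst.
- apply: aeW => t j _; rewrite indicE /= lee_fin.
  by case: (_ \in _); rewrite ?normr1 ?normr0.
have -> : (fun n => \int[Q]_x (\1_(A_ n) x)%:E)%E = (fun j => Q (A_ j)).
  by apply/funext => j; rewrite integral_indic// setIT.
by rewrite integral_indic// setIT.
Qed.

Lemma cvg_integral_bounded d (T : measurableType d) (R : realType)
    (m : probability T R) (h : nat -> T -> \bar R) (c : R) :
  (forall j, measurable_fun setT (h j)) -> (forall j t, 0 <= h j t <= 1)%E ->
  (forall t, h j t @[j --> \oo] --> c%:E)%E ->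
  (\int[m]_t h j t @[j --> \oo] --> c%:E)%E.
Proof.
move=> mh h01 hc.
have [|||||_ _] := @dominated_convergence _ T R m setT measurableT h (cst c%:E) (cst 1%E).
- by [].
- exact: measurable_cst.
- by apply: aeW => t _; exact: hc.
- exact: finite_measure_integrable_cst.
- by apply: aeW => t j _; have /andP[h0 h1] := h01 j t; rewrite gee0_abs.
- by rewrite integral_cst// [X in (_ * X)%E](_ : _ = 1%E) ?mule1//; exact: probability_setT.
Qed.

(** * A stationary law is determined by the laws of its finite words *)

Section stationary_laws.
Context {R : realType} {N : option nat}.
Local Notation A := (alphabet N).
Local Notation past := (past N).
Local Notation path_space := (path_space N).
Local Notation shift := (@Defs.shift N).

Definition last_word n (x : past) : seq A := mkseq (fun i => x (n - i.+1)%N) n.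

Lemma agree_last_word (x y : past) w :
  agree (size w) y (append x w) <-> last_word (size w) y = w.
Proof.
split=> [yx|yw i iw].
  apply: (@eq_from_nth _ point) => [|i]; rewrite size_mkseq// => iw.
  by rewrite nth_mkseq// yx ?append_lt; first 1 [congr nth] || lia; lia.
have := congr1 (fun v => nth point v (size w - i.+1)) yw.
rewrite append_lt// nth_mkseq; last by lia.
by move=> <-; congr (y _); lia.
Qed.

Lemma drop_last_word j n (x : past) :
  drop j (last_word (j + n) x) = last_word n x.
Proof.
apply: (@eq_from_nth _ point) => [|i]; rewrite size_drop !size_mkseq; first lia.
by move=> iw; rewrite nth_drop !nth_mkseq; [congr (x _)|..]; lia.
Qed.

Lemma measurable_last_word n w : measurable [set x : past | last_word n x = w].
Proof.
have [<-|nw] := eqVneq (size w) n.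
  rewrite (_ : [set x | _] = [set x : past | agree (size w) x (append point w)]).
    exact: measurable_agree.
  by apply/seteqP; split=> x /= /(agree_last_word point).
rewrite (_ : [set x | _] = set0)//; apply/seteqP; split=> x //= xw.
by move: nw; rewrite -xw size_mkseq eqxx.
Qed.

Lemma measurable_preimage_past_of (B : set past) :
  measurable B -> measurable (past_of @^-1` B : set path_space).
Proof. by move=> mB; rewrite -[X in measurable X]setTI; exact: measurable_past_of. Qed.

Lemma iter_shift k (y : path_space) t : iter k shift y t = y (t + k%:Z).
Proof.
elim: k t => [|k IH] t /=; first by rewrite addr0.
by rewrite /Defs.shift IH -addrA -[X in _ + X]PoszD add1n.
Qed.

Lemma measurable_iter_shift k : measurable_fun setT (iter k shift).
Proof.
apply: measurable_to_path => t a.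
rewrite (_ : [set y | _] = [set y : path_space | y (t + k%:Z) = a]).
  exact: measurable_path_coord.
by apply/seteqP; split=> y /=; rewrite iter_shift.
Qed.

Lemma stationary_iter (mu : probability path_space R) k B : stationary mu ->
  measurable B -> mu (iter k shift @^-1` B) = mu B.
Proof.
move=> smu mB; elim: k => [|k IH]; first by congr (mu _).
rewrite -IH -[RHS]smu; last first.
  by rewrite -[X in measurable X]setTI; exact: measurable_iter_shift.
by congr (mu _); apply/seteqP; split=> y; rewrite /preimage/= -iterSr.
Qed.

Definition window (c : nat) (z : path_space) : set path_space :=
  [set y | forall t : int, (absz t <= c)%N -> y t = z t].

(** The empty set makes the family closed under intersection, and the whole space gives the cover
    that [measure_unique] asks for. *)
Definition windows : set (set path_space) :=
  [set C | C = set0 \/ C = setT \/ exists c z, C = window c z].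

Lemma measurable_windows : windows `<=` measurable.
Proof.
move=> _ [->|[->|[c [z ->]]]] //.
by apply: measurable_forallC => t; apply: measurable_impl => _; exact: measurable_path_coord.
Qed.

(** All windows are centred at 0, hence nested in time: two that meet intersect in the window of
    larger radius around any common path. *)
Lemma setI_closed_windows : setI_closed windows.
Proof.
move=> A B [->|[->|[c [z ->]]]]; first by rewrite set0I; left.
  by rewrite setTI.
move=> [->|[->|[c' [z' ->]]]]; first by rewrite setI0; left.
  by rewrite setIT; right; right; exists c, z.
have [->|/set0P[y [yz yz']]] := eqVneq (window c z `&` window c' z') set0.
  by left.
right; right; exists (maxn c c'), y; apply/seteqP; split=> v.
  move=> [vz vz'] t; rewrite leq_max => /orP[tc|tc].
    by rewrite vz// yz.
  by rewrite vz'// yz'.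
move=> vy; split=> t tc; rewrite vy ?leq_max ?tc ?orbT//; [exact: yz|exact: yz'].
Qed.

(** A one-coordinate cylinder is a countable union of windows, one for each word read around 0. *)
Lemma windows_generate : <<s windows >> = @measurable _ path_space.
Proof.
apply/seteqP; split.
  apply: smallest_sub; first exact: sigma_algebra_measurable.
  exact: measurable_windows.
apply: smallest_sub; first exact: smallest_sigma_algebra.
move=> _ [t [a ->]].
(* Position 0 of [w] is read at time -|t|; the letters outside the window are irrelevant. *)
pose z (w : seq A) : path_space := fun s => nth point w (absz (s + (absz t)%:Z)%R).
rewrite (_ : [set x | _] = \bigcup_(w in [set: seq A])
    (if z w t == a then window (absz t) (z w) else set0)).
  apply: (@countable_bigcupT_measurable _ (g_sigma_algebraType windows)).
    exact: countableP.
  move=> w; apply: sub_sigma_algebra; case: ifP => _; last by left.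
  by right; right; exists (absz t), (z w).
apply/seteqP; split=> x /=.
  move=> xt; pose w := mkseq (fun i => x (i%:Z - (absz t)%:Z)) (absz t + absz t).+1.
  have zx s : (absz s <= absz t)%N -> z w s = x s.
    move=> st; rewrite /z nth_mkseq; last by lia.
    by congr (x _); lia.
  exists w => //; rewrite zx// xt eqxx => s st; by rewrite zx.
move=> [w _]; case: ifP => // /eqP <-; exact.
Qed.

(** Up to a shift a window is an event on the last 2c + 1 letters of the past, and windows form a
    generating pi-system. *)
Lemma stationary_unique (mu nu : probability path_space R) :
  stationary mu -> stationary nu ->
  (forall n w, mu [set y | last_word n (past_of y) = w] =
               nu [set y | last_word n (past_of y) = w]) ->
  forall B, measurable B -> mu B = nu B.
Proof.
move=> smu snu munu.
apply: (@measure_unique _ R path_space windows (fun=> setT) _ _ _ _ mu nu) => //.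
- by rewrite windows_generate.
- exact: setI_closed_windows.
- by move=> _; right; left.
- by apply/seteqP; split=> // x _; exists 0%N.
- move=> _ [->|[->|[c [z ->]]]].
  + by rewrite !measure0.
  + by transitivity (1%:E : \bar R); [|apply/esym]; exact: probability_setT.
  (* The shift by c + 1 brings the last time c of the window to time -1. *)
  have -> : window c z = iter c.+1 shift @^-1` (past_of @^-1`
      [set x | last_word (c + c).+1 x = mkseq (fun i => z (i%:Z - c%:Z)) (c + c).+1]).
    apply/seteqP; split=> y /=.
      move=> yz; apply: (@eq_from_nth _ point); rewrite !size_mkseq// => i ic.
      rewrite !nth_mkseq// /past_of -iterS iter_shift -yz; last by lia.
      by congr (y _); lia.
    move=> yz t tc; have := congr1 (fun w => nth point w (absz (t + c%:Z)%R)) yz.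
    rewrite -iterS !nth_mkseq ?[past_of _ _]iter_shift; [|lia..].
    have -> : (absz (t + c%:Z)%R)%:Z - c%:Z = t by lia.
    move=> <-; congr (y _); lia.
  have mB := measurable_preimage_past_of (measurable_last_word (c + c).+1
    (mkseq (fun i => z (i%:Z - c%:Z)) (c + c).+1)).
  transitivity (mu (past_of @^-1`
      [set x | last_word (c + c).+1 x = mkseq (fun i => z (i%:Z - c%:Z)) (c + c).+1])).
    exact: stationary_iter.
  by rewrite [LHS]munu; apply/esym; exact: stationary_iter.
- by move=> _; rewrite [ltLHS](_ : _ = 1%E) ?ltry//; exact: probability_setT.
Qed.

End stationary_laws.

(** * Coupling from the past *)

Section coalescence.
Context {R : realType} {N : option nat}.
Local Notation A := (alphabet N).
Local Notation past := (past N).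
Local Notation path_space := (path_space N).
Variable G : past -> R -> A.

(** Starting at time 1 - l makes 0 the last of the l times; for l = 0 the value is the default
    letter. *)
Definition current l (x : past) (u : rseq R) : A :=
  last point (word G (1 - l%:Z) l x u).

Definition coalesces (u : rseq R) := exists l a, forall x, current l.+1 x u = a.

(** Only the past [point] is used, which keeps the quantifiers countable and the limit measurable;
    under [coalesces] every past leads to the same letter. *)
Definition limit_letter (u : rseq R) : A := xget point
  [set a | exists l, forall l', (l <= l')%N -> current l' point u = a].

Definition limit_path (u : rseq R) : path_space :=
  fun t => limit_letter (translate t u).

(** A run started earlier reaches time -l with some past, from which the shorter run takes over, and
    the latter gives [a] from any past. *)
Lemma current_stable l a u : (forall x, current l.+1 x u = a) ->
  forall l' x, (l < l')%N -> current l' x u = a.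
Proof.
move=> la l' x ll'; rewrite /current -(subnK ll') word_add last_cat.
rewrite -[RHS](la (append x (word G (1 - ((l' - l.+1 + l.+1)%N : nat)%:Z) (l' - l.+1) x u))).
rewrite /current /= !last_rcons.
have -> : 1 - (l' - l.+1 + l.+1)%N%:Z + (l' - l.+1)%N%:Z = 1 - l.+1%:Z by lia.
by [].
Qed.

Lemma limit_letterE l a u : (forall l', (l <= l')%N -> current l' point u = a) ->
  limit_letter u = a.
Proof.
move=> la; apply: xget_unique; first by exists l.
move=> b [k kb]; rewrite -(kb (maxn l k)) ?leq_maxr//.
by rewrite la// leq_maxl.
Qed.

Lemma coalesces_limit u : coalesces u ->
  exists L, forall l x, (L <= l)%N -> current l x u = limit_letter u.
Proof.
move=> [l [a la]]; exists l.+1 => k x lk.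
have := current_stable la; move=> h; rewrite h//.
by apply/esym/(@limit_letterE l.+1) => l' /h.
Qed.

Lemma nth_word m l i x u : (i < l)%N ->
  nth point (word G m l x u) i = last point (word G m i.+1 x u).
Proof.
move=> il; rewrite -(subnKC il) word_add nth_cat size_word ltnSn.
by rewrite -nth_last size_word.
Qed.

Lemma nth_word_current n j i x u : (i < n)%N ->
  nth point (word G (1 - (j + n)%N%:Z) (j + n) x u) (j + i) =
  current (j + i).+1 x (translate (i%:Z + 1 - n%:Z) u).
Proof.
move=> ni; rewrite nth_word; last by lia.
rewrite /current word_translate; congr (last _ (word _ _ _ _ _)); lia.
Qed.

Lemma translateD s t (u : rseq R) : translate s (translate t u) = translate (s + t) u.
Proof. by apply/funext => n; rewrite /translate addrA. Qed.

Lemma limit_path_translate t u n :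
  limit_path (translate t u) n = limit_path u (n + t).
Proof. by rewrite /limit_path translateD. Qed.

(** Only n letters are inspected, so one J bounds all their coalescence times. [translate 1] aligns
    a word ending at time 0 with a past ending at time -1. *)
Lemma drop_word_limit n w u : (forall t, coalesces (translate t u)) ->
  exists J, forall j x, (J <= j)%N ->
    drop j (word G (1 - (j + n)%N%:Z) (j + n) x u) = w <->
    last_word n (past_of (limit_path (translate 1 u))) = w.
Proof.
move=> cu.
have [J HJ] : exists J, forall i j x, (i < n)%N -> (J <= j)%N ->
    current j x (translate (i%:Z + 1 - n%:Z) u) =
    limit_letter (translate (i%:Z + 1 - n%:Z) u).
  elim: {1}n => [|n' [J IH]]; first by exists 0%N.
  have [L HL] := coalesces_limit (cu (n'%:Z + 1 - n%:Z)).
  exists (maxn J L) => i j x; rewrite geq_max ltnS leq_eqVlt.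
  by move=> /predU1P[->|ni] /andP[Jj Lj]; [exact: HL|exact: IH].
exists J => j x Jj; have -> // : drop j (word G (1 - (j + n)%N%:Z) (j + n) x u) =
  last_word n (past_of (limit_path (translate 1 u))).
apply: (@eq_from_nth _ point) => [|i]; rewrite size_drop size_word ?size_mkseq; first lia.
rewrite addKn => ni; rewrite nth_drop nth_word_current// HJ//; last by lia.
rewrite nth_mkseq// /past_of limit_path_translate /limit_path.
by rewrite (_ : i%:Z + 1 - n%:Z = - (n - i.+1).+1%:Z + 1)//; lia.
Qed.

Hypothesis mG : forall x a, measurable [set v | G x v = a].

Lemma measurable_limit_letter a : measurable [set u | limit_letter u = a].
Proof.
pose E b := [set u | exists l, forall l', (l <= l')%N -> current l' point u = b].
have mE b : measurable (E b : set (rseq R)).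
  apply: measurable_existsC => l; apply: measurable_forallC => l'.
  apply: measurable_impl => _.
  exact: (measurable_word_pred mG (1 - l'%:Z) l' point (fun w => last point w = b)).
(* The second set is the default value of [xget], taken when no letter is eventually constant. *)
rewrite (_ : [set u | _] = E a `|`
    ([set u | a = point] `&` [set u | forall b, (~` E b) u])).
  apply: measurableU; first exact: mE.
  apply: measurableI; first exact: (@measurable_Prop _ _ (a = point)).
  by apply: measurable_forallC => b; apply: measurableC; exact: mE.
apply/seteqP; split=> u /=; last first.
  case=> [[l]|[-> nE]]; first exact: limit_letterE.
  by rewrite /limit_letter xgetPN// => b Eb; exact: (nE b).
move=> <-; have [[b [l lb]]|nE] := pselect (exists b, E b u).
  by left; rewrite (limit_letterE lb); exists l.
by right; split; [apply: xgetPN => b Eb; apply: nE; exists b|move=> b Eb; apply: nE; exists b].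
Qed.

Lemma measurable_limit_path : measurable_fun setT limit_path.
Proof.
apply: measurable_to_path => t a.
rewrite -[X in measurable X]setTI.
exact: (measurable_translate t measurableT (measurable_limit_letter a)).
Qed.

Variable Q : probability (rseq R) R.
Hypothesis hQ : iid_law Q.

(** [coalesces] quantifies over all pasts and is not evidently measurable, so a measurable subset of
    full probability stands for it; invariance under translations then covers the countably many
    times. *)
Lemma ae_coalesces (C : set (rseq R)) : measurable C -> Q C = 1%E ->
  C `<=` coalesces -> {ae Q, forall u, forall t, coalesces (translate t u)}.
Proof.
move=> mC QC Cc; apply: ae_forallC => t.
exists (~` (translate t @^-1` C)).
have mtC : measurable (translate t @^-1` C).
  by rewrite -[X in measurable X]setTI; exact: measurable_translate.
split; first exact: measurableC.
- transitivity (1 - Q (translate t @^-1` C))%E; first exact: probability_setC.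
  by rewrite iid_law_translate// QC subee.
- by move=> u /= nc Cu; apply: nc; exact: Cc.
Qed.

Hypothesis mstep : forall a, measurable_fun setT (fun x : past => step_prob G x a).
Variable mu : probability path_space R.
Hypothesis smu : stationary mu.
Hypothesis dmu : driven G mu.

Lemma measurable_drop_word j n x w :
  measurable [set u : rseq R | drop j (word G (1 - (j + n)%N%:Z) (j + n) x u) = w].
Proof. exact: (measurable_word_pred mG _ _ _ [set v | drop j v = w]). Qed.

Lemma prob_drop_word j n x w :
  (Q [set u | drop j (word G (1 - (j + n)%N%:Z) (j + n) x u) = w] =
   \esum_(v in [set v | size v = (j + n)%N /\ drop j v = w]) (word_prob G x v)%:E)%E.
Proof.
rewrite (_ : [set u | _] = \bigcup_(v in [set v | size v = (j + n)%N /\ drop j v = w])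
    [set u | word G (1 - (j + n)%N%:Z) (j + n) x u = v]); last first.
  apply/seteqP; split=> u /=; last by move=> [v /= [_ <-] ->].
  by move=> uw; exists (word G (1 - (j + n)%N%:Z) (j + n) x u) => //=; rewrite size_word.
rewrite measure_bigcup_countType.
- by apply: eq_esum => v [<- _]; exact: prob_word.
- by move=> v _; exact: measurable_word.
- by move=> v v' _ _ [u [/= -> ->]].
Qed.

(** The recursion started from a past drawn from [mu] reproduces [mu]. The number [j] of discarded
    letters is free, and [cftp_law] sends it to infinity. *)
Lemma mu_last_word j n w : (mu [set y | last_word n (past_of y) = w] =
  \int[mu]_y Q [set u | drop j (word G (1 - (j + n)%N%:Z) (j + n) (past_of y) u) = w])%E.
Proof.
under eq_integral do rewrite prob_drop_word.
rewrite ge0_integral_esum; last 2 first.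
- move=> v _; apply/measurable_EFinP.
  exact: (measurableT_comp (measurable_word_prob mstep v) measurable_past_of).
- by move=> v y _; rewrite lee_fin; exact: word_prob_ge0.
rewrite (_ : [set y | _] = \bigcup_(v in [set v | size v = (j + n)%N /\ drop j v = w])
    [set y | last_word (j + n) (past_of y) = v]); last first.
  apply/seteqP; split=> y /=; last first.
    by move=> [v /= [_ <-] <-]; rewrite drop_last_word.
  move=> yw; exists (last_word (j + n) (past_of y)) => //=.
  by rewrite size_mkseq drop_last_word.
rewrite measure_bigcup_countType.
- apply: eq_esum => v [<- _]; rewrite (integral_word_probT mG mstep smu dmu v point).
  by congr (mu _); apply/seteqP; split=> y /=; have [] := agree_last_word point (past_of y) v.
- by move=> v _; exact: (measurable_preimage_past_of (measurable_last_word _ _)).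
- by move=> v v' _ _ [u [/= -> ->]].
Qed.

Hypothesis aec : {ae Q, forall u, forall t, coalesces (translate t u)}.

(** In [mu_last_word] the left side is constant in [j] while the integrand converges to the
    corresponding probability for [limit_path]; bounded convergence identifies the word laws and
    [stationary_unique] concludes. *)
Lemma cftp_law B : measurable B -> mu B = Q (limit_path @^-1` B).
Proof.
have [nu nuE] := pushforward_probability Q measurable_limit_path.
move=> mB; rewrite -nuE; move: B mB.
have mlB B : measurable B -> measurable (limit_path @^-1` B).
  by move=> mB; rewrite -[X in measurable X]setTI; exact: measurable_limit_path.
apply: stationary_unique => //.
  move=> B mB; rewrite !nuE -[RHS](iid_law_translate 1 hQ (mlB _ mB)).
  have shiftE u : Defs.shift (limit_path u) = limit_path (translate 1 u).
    by apply/funext => t; rewrite limit_path_translate.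
  by congr (Q _); apply/seteqP; split=> u; rewrite /preimage/= shiftE.
move=> n w; rewrite nuE.
have mE : measurable (limit_path @^-1` [set y | last_word n (past_of y) = w]).
  exact: mlB (measurable_preimage_past_of (measurable_last_word _ _)).
rewrite -(iid_law_translate 1 hQ mE).
set E := (X in Q X).
have mE' : measurable E.
  by rewrite /E -[X in measurable X]setTI; exact: measurable_translate.
pose h j y := Q [set u | drop j (word G (1 - (j + n)%N%:Z) (j + n) (past_of y) u) = w].
(* Coalescence makes this limit independent of the starting past [y]. *)
have hcvg y : (h j y @[j --> \oo] --> Q E)%E.
  apply: cvg_probability_ae => // [j|]; first exact: measurable_drop_word.
  apply: filterS aec => u cu; have [J HJ] := drop_word_limit n w cu.
  by exists J => j Jj; apply: HJ.
have QEfin : Q E = (fine (Q E))%:E by rewrite fineK// fin_num_measure.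
rewrite QEfin in hcvg *.
have : (\int[mu]_y h j y @[j --> \oo] --> (fine (Q E))%:E)%E.
  apply: cvg_integral_bounded => //.
  (* Measurability in the starting past is read off the expansion over words. *)
  - move=> j; pose S := [set v : seq A | size v = (j + n)%N /\ drop j v = w].
    have -> : h j = (fun y => \sum_(i <oo) oapp (fun v => if v \in S
       then (word_prob G (past_of y) v)%:E else 0) 0 (pickle_inv i))%E.
      apply/funext => y; rewrite /h prob_drop_word esum_countType// => v _.
      by rewrite lee_fin; exact: word_prob_ge0.
    apply: ge0_emeasurable_sum.
      move=> i y _ _; case: pickle_inv => [v|]//=; case: ifP => // _.
      by rewrite lee_fin; exact: word_prob_ge0.
    move=> i _; case: (pickle_inv i) => [v|]//=; case: (v \in S) => //.
    apply/measurable_EFinP.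
    exact: (measurableT_comp (measurable_word_prob mstep v) measurable_past_of).
  - by move=> j y; rewrite measure_ge0 probability_le1//; exact: measurable_drop_word.
rewrite (_ : (fun j => _) = cst (mu [set y | last_word n (past_of y) = w])); last first.
  by apply/funext => j; rewrite [RHS](mu_last_word j).
by move/(cvg_lim (@ereal_hausdorff R)); rewrite lim_cst// => ->.
Qed.

End coalescence.

(** * Range partitions *)

(** [uniform_prob] lives on the closed unit interval and the range partitions on the half-open one;
    the point 1 is null. *)
Lemma uniform_prob01E (R : realType) (B : set R) : measurable B ->
  uniform_prob (@ltr01 R) B = lebesgue_measure (B `&` `[0, 1[).
Proof.
move=> mB; rewrite /uniform_prob integral_uniform_pdf.
rewrite (eq_integral (cst 1%E)); last first.
  by move=> x; rewrite inE/= => -[_]; rewrite in_itv/= /uniform_pdf => ->; rewrite subr0 invr1.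
rewrite integral_cst ?mul1e; last exact: measurableI.
rewrite (_ : B `&` `[0, 1] = (B `&` `[0, 1[) `|` (B `&` [set 1])); last first.
  apply/seteqP; split=> x /=; rewrite !in_itv/=.
    move=> [Bx /andP[x0]]; rewrite le_eqVlt => /orP[/eqP x1|x1]; first by right.
    by left; rewrite x0.
  move=> [[Bx /andP[x0 x1]]|[Bx x1]]; split => //.
    by rewrite x0 ltW.
  by rewrite x1 ler01 lexx.
apply: measureU0; [exact: measurableI|exact: measurableI|].
apply/eqP; rewrite -measure_le0 -(lebesgue_measure_set1 (1 : R)).
by apply: le_measure; rewrite ?inE//; apply: measurableI.
Qed.

Lemma lebesgue_measure_itvco (R : realType) (a b : R) : a <= b ->
  lebesgue_measure (`[a, b[%classic : set R) = (b - a)%:E.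
Proof.
move=> ab; rewrite lebesgue_measure_itv/= lte_fin; case: ltP => // ba.
by rewrite (@le_anti _ _ a b) ?subrr// ab ba.
Qed.

Section range_partition.
Context {R : realType} {N : option nat}.
Local Notation A := (alphabet N).
Local Notation past := (past N).
Local Notation index := (option nat * A)%type.
Local Notation leb := (@lebesgue_measure R).
Local Notation F := (@Defs.F R N).
Local Notation L := (@Defs.L R N).
Variables (P : A -> past -> R) (I : past -> option nat -> A -> set R).
Hypothesis hI : range_partitions P I.
Implicit Types (x y : past) (p q : index) (S : set index) (k : nat).

Lemma index_lt_total p q : [\/ p = q, index_lt p q | index_lt q p].
Proof.
case: p q => [[i|] a] [[j|] b]; rewrite /index_lt/=.
- have [ij|ij|<-] := ltngtP i j; [by constructor 2|by constructor 3|].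
  rewrite ?eqxx ?ltnn /=; have [ab|ab|ab] := ltngtP (val a) (val b);
    [by constructor 2|by constructor 3|].
  by constructor 1; rewrite (val_inj ab).
- by constructor 2.
- by constructor 3.
- rewrite ?eqxx ?ltnn /=; have [ab|ab|ab] := ltngtP (val a) (val b);
    [by constructor 2|by constructor 3|].
  by constructor 1; rewrite (val_inj ab).
Qed.

Lemma index_lt_trans p q r : index_lt p q -> index_lt q r -> index_lt p r.
Proof.
case: p q r => [[i|] a] [[j|] b] [[l|] c]; rewrite /index_lt/= ?orbF ?orFb//.
- move=> /orP[ij|/andP[/eqP[<-] ab]] /orP[jl|/andP[/eqP[<-] bc]].
  + by rewrite (ltn_trans ij jl).
  + by rewrite ij.
  + by rewrite jl.
  + by rewrite (ltn_trans ab bc) eqxx orbT.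
- by exact: ltn_trans.
Qed.

Definition segment x S := \bigcup_(p in S) I x p.1 p.2.

Lemma measurable_range x (o : option nat) a : measurable (I x o a).
Proof. by have [l [r ->]] := rp_interval hI x o a; exact: measurable_itv. Qed.

Lemma measurable_segment x S : measurable (segment x S).
Proof.
rewrite (_ : segment x S = [set u | exists p, S p /\ I x p.1 p.2 u]).
  apply: measurable_existsC => p; apply: measurableI; first exact: measurable_Prop.
  exact: measurable_range.
by apply/seteqP; split=> u /=; [move=> [p]; exists p|move=> [p []]; exists p].
Qed.

Lemma segment01 x S : segment x S `<=` `[0, 1[.
Proof. by move=> u [p Sp Iu]; rewrite -(rp_cover hI x); exists p. Qed.

Lemma range_exists x u : 0 <= u < 1 -> exists p, I x p.1 p.2 u.
Proof.
move=> u01; have : `[0, 1[%classic u by rewrite /= in_itv.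
by rewrite -(rp_cover hI x) => -[p _]; exists p.
Qed.

Lemma range_unique x p q u : I x p.1 p.2 u -> I x q.1 q.2 u -> p = q.
Proof. by move=> Ip Iq; apply: (rp_disjoint hI (x := x)) => //; exists u. Qed.

Lemma range_indexE x p u : I x p.1 p.2 u -> range_index I x u = p.
Proof. by move=> Ip; apply: xget_unique => // q Iq; exact: (range_unique Iq Ip). Qed.

Lemma range_index_out x u : ~ `[0, 1[%classic u -> range_index I x u = (None, point).
Proof.
move=> nu; apply: xgetPN => p Ip; apply: nu.
by rewrite -(rp_cover hI x); exists p.
Qed.

Lemma segment_mass x S : leb (segment x S) = (\esum_(p in S) leb (I x p.1 p.2))%E.
Proof.
rewrite measure_bigcup_countType// => [p _|p q _ _ pq].
  exact: measurable_range.
by apply: (rp_disjoint hI (x := x)).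
Qed.

Lemma segment_fin x S : leb (segment x S) \is a fin_num.
Proof.
rewrite ge0_fin_numE//; apply: (@le_lt_trans _ _ (leb `[0, 1[)).
  by apply: le_measure; rewrite ?inE//; [exact: measurable_segment|exact: segment01].
by rewrite lebesgue_measure_itvco// ltry.
Qed.

Definition closed_below S := forall p q, S q -> index_lt p q -> S p.

(** The intervals are ordered and cover [0, 1[, so an initial set of indices fills an initial
    interval, whose right end is its measure. This is how positions are recovered from lengths. *)
Lemma segment_itv x S : closed_below S ->
  segment x S = `[0, fine (leb (segment x S))[%classic.
Proof.
move=> Sdown; set m := fine _.
have mE : leb (segment x S) = m%:E by rewrite fineK ?segment_fin.
have down u t : segment x S u -> 0 <= t <= u -> segment x S t.
  move=> Su /andP[t0 tu]; have /= := segment01 Su; rewrite in_itv/= => /andP[_ u1].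
  have [|q Iq] := @range_exists x t; first by rewrite t0 (le_lt_trans tu).
  case: Su => p Sp Ip; exists q => //.
  have [->//|qp|pq] := index_lt_total q p; first exact: Sdown qp.
  by have := rp_order hI pq Ip Iq; rewrite ltNge tu.
have m0 : 0 <= m by rewrite fine_ge0.
apply/seteqP; split=> u.
  move=> Su; have /= := segment01 Su; rewrite !in_itv/= => /andP[u0 _]; rewrite u0/=.
  case: (Su) => p Sp; have [l [r Ilr]] := rp_interval hI x p.1 p.2.
  rewrite Ilr /= in_itv/= => /andP[lu ur]; apply: (lt_le_trans ur).
  rewrite -lee_fin -mE -[r]subr0 -lebesgue_measure_itvco; last exact: le_trans (ltW ur).
  apply: le_measure; rewrite ?inE//; first exact: measurable_segment.
  move=> t /=; rewrite in_itv/= => /andP[t0 tr].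
  have [tu|ut] := leP t u; first by apply: (down u) => //; rewrite t0.
  by exists p => //; rewrite Ilr /= in_itv/= tr (le_trans lu (ltW ut)).
rewrite /= in_itv/= => /andP[u0 um]; apply: contrapT => nSu.
move: um; rewrite ltNge -lee_fin -mE -[u]subr0 -(lebesgue_measure_itvco u0) => /negP; apply.
apply: le_measure; rewrite ?inE//; first exact: measurable_segment.
move=> t St /=; have /= := segment01 St; rewrite !in_itv/= => /andP[t0 _]; rewrite t0/=.
by rewrite ltNge; apply/negP => ut; apply: nSu; apply: (down t) => //; rewrite u0.
Qed.

Definition up_to_level k : set index := [set p | exists2 j, (j <= k)%N & p.1 = Some j].

Lemma closed_below_up_to_level k : closed_below (up_to_level k).
Proof.
move=> [pl a] [ql b] [j jk /= ->]; rewrite /index_lt/=.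
case: pl => [i|]//=.
by move=> /orP[ij|/andP[/eqP[->] _]]; [exists i => //; exact: leq_trans (ltnW ij) jk|exists j].
Qed.

Lemma segment_mass_agree k x y S : agree k x y -> S `<=` up_to_level k ->
  leb (segment x S) = leb (segment y S).
Proof.
move=> xy Sk; rewrite !segment_mass; apply: eq_esum => -[l a] /Sk[j jk /= ->].
exact/(rp_length hI)/(agreeW jk).
Qed.

Lemma segment_agree k x y S : agree k x y -> S `<=` up_to_level k ->
  closed_below S -> segment x S = segment y S.
Proof.
by move=> xy Sk Sd; rewrite segment_itv// [RHS]segment_itv// (segment_mass_agree xy).
Qed.

(** [rp_length] controls lengths only. The interval is the difference of two initial segments of
    levels at most k, and each of these is determined by lengths. *)
Lemma range_agree k a x y : agree k x y -> I x (Some k) a = I y (Some k) a.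
Proof.
move=> xy; pose p : index := (Some k, a).
pose S1 := [set q | index_lt q p]; pose S2 := [set q | q = p \/ index_lt q p].
have S1d : closed_below S1 by move=> q r rp qr; exact: index_lt_trans rp.
have S2d : closed_below S2.
  by move=> q r [->|rp] qr; right => //; exact: index_lt_trans rp.
have S1k : S1 `<=` up_to_level k.
  move=> [[i|] b]; rewrite /S1/index_lt//=.
  by move=> /orP[ik|/andP[/eqP[->] _]]; [exists i => //; exact: ltnW|exists k].
have S2k : S2 `<=` up_to_level k by move=> q [->|/S1k//]; exists k.
have nltp : ~~ index_lt p p by rewrite /index_lt/= !ltnn eqxx.
suff IE z : I z (Some k) a = segment z S2 `\` segment z S1.
  by rewrite !IE (segment_agree xy S1k)// (segment_agree xy S2k).
apply/seteqP; split=> u.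
  move=> Iu; split; first by exists p => //; left.
  move=> [q qp Iq]; move: qp; rewrite /S1/=.
  by rewrite (range_unique (q := p) Iq Iu) (negbTE nltp).
by move=> [[q [-> //|qp Iq]] nS1]; exfalso; apply: nS1; exists q.
Qed.

Definition level_mass k x : R := fine (leb (segment x (up_to_level k))).

Lemma level_mass_agree k x y : agree k x y -> level_mass k x = level_mass k y.
Proof. by move=> xy; rewrite /level_mass (segment_mass_agree xy). Qed.

Lemma segment_level k x : segment x (up_to_level k) = `[0, level_mass k x[%classic.
Proof. exact/segment_itv/closed_below_up_to_level. Qed.

Lemma level_mass_ge0 k x : 0 <= level_mass k x.
Proof. by rewrite fine_ge0. Qed.

Lemma level_mass_le1 k x : level_mass k x <= 1.
Proof.
rewrite -lee_fin fineK ?segment_fin// -[1]subr0 -lebesgue_measure_itvco ?ler01//.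
by apply: le_measure; rewrite ?inE//; [exact: measurable_segment|exact: segment01].
Qed.

Lemma level_mass_mono j k x : (j <= k)%N -> level_mass j x <= level_mass k x.
Proof.
move=> jk; rewrite fine_le ?segment_fin//.
apply: le_measure; rewrite ?inE//; [exact: measurable_segment|exact: measurable_segment|].
by move=> u [p [i ij pi] Iu]; exists p => //; exists i => //; exact: leq_trans ij jk.
Qed.

(** This turns the condition in [Theta'] into an interval condition on [u]. Outside [0, 1[ the
    default index has level oo, so both sides fail there. *)
Lemma level_leP k x u : level_le_int (L I x u) k%:Z <-> 0 <= u < level_mass k x.
Proof.
have -> : is_true (0 <= u < level_mass k x) = (`[0, level_mass k x[%classic : set R) u.
  by rewrite /= in_itv.
rewrite -segment_level.
split=> [|[[l a] [j jk /= ->] Iu]]; last first.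
  by rewrite /Defs.L (range_indexE (p := (Some j, a)) Iu)/= lez_nat.
rewrite /Defs.L /range_index; case: xgetP => //= -[[j|] a] _ //= Iu jk.
by exists (Some j, a) => //; exists j => //; rewrite -lez_nat.
Qed.

Lemma F_agree k x y u : agree k x y -> 0 <= u < level_mass k x -> F I x u = F I y u.
Proof.
move=> xy ux; have : segment x (up_to_level k) u by rewrite segment_level /= in_itv.
move=> [[l a] [j jk /= ->] Iu].
rewrite /Defs.F (range_indexE (p := (Some j, a)) Iu) (range_indexE (p := (Some j, a)))//=.
by rewrite -(range_agree _ (agreeW jk xy)).
Qed.

Lemma F_out x u : ~ `[0, 1[%classic u -> F I x u = point.
Proof. by move=> nu; rewrite /Defs.F range_index_out. Qed.

Lemma F_fiber01 x a : [set u | F I x u = a] `&` `[0, 1[ = \bigcup_k I x k a.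
Proof.
apply/seteqP; split=> u /=; rewrite in_itv/=.
  move=> [Fa /(range_exists x)[[l b] Iu]]; exists l => //.
  by move: Fa; rewrite /Defs.F (range_indexE Iu) /= => <-.
move=> [l _ Iu]; split; first by rewrite /Defs.F (range_indexE (p := (l, a)) Iu).
have Su : segment x setT u by exists (l, a).
by have /= := segment01 Su; rewrite in_itv.
Qed.

Lemma measurable_F x a : measurable [set u | F I x u = a].
Proof.
rewrite (_ : [set u | _] = ([set u | F I x u = a] `&` `[0, 1[) `|`
    ([set u : R | a = point] `&` ~` `[0, 1[)).
  rewrite F_fiber01; apply: measurableU.
    by apply: countable_bigcupT_measurable => [|k]; [exact: countableP|exact: measurable_range].
  by apply: measurableI; [exact: measurable_Prop|exact: measurableC].
apply/seteqP; split=> u /=; last by move=> [[]//|[-> /F_out]].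
have [u01|u01] := pselect (`[0, 1[%classic u); first by left.
by move=> Fa; right; split => //; rewrite -Fa F_out.
Qed.

Lemma step_prob_F x a : step_prob (F I) x a = P a x.
Proof.
rewrite /step_prob uniform_prob01E; last exact: measurable_F.
rewrite F_fiber01 measure_bigcup_countType; first by rewrite (rp_sum hI).
  by move=> k _; exact: measurable_range.
move=> k l _ _ kl; have : (k, a) = (l, a); last by case.
by case: kl => u [Iu Iu']; exact: (@range_unique x (k, a) (l, a) u).
Qed.

End range_partition.

(** * The update function of the Markov approximation *)

Section quantile.
Context {R : realType} {V : countType}.
Variables (v0 : V) (c : R) (r : V -> R).

(** The cells start at [c] and follow the order of the codes; a code that stands for no element has
    length 0. *)
Definition cumulative n : R := c + \sum_(0 <= i < n) oapp r 0 (pickle_inv i).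
Definition cell (v : V) : set R := `[cumulative (pickle v), cumulative (pickle v).+1[%classic.
Definition quantile u : V := xget v0 [set v | cell v u].

Hypothesis r0 : forall v, 0 <= r v.

Let s0 i : 0 <= oapp r 0 (@pickle_inv V i).
Proof. by case: pickle_inv => //=. Qed.

Lemma cumulative_mono m n : (m <= n)%N -> cumulative m <= cumulative n.
Proof.
move=> mn; rewrite lerD2l [leRHS](big_cat_nat (n := m))//=.
by rewrite lerDl; apply: sumr_ge0 => i _; exact: s0.
Qed.

Lemma lebesgue_measure_cell v : lebesgue_measure (cell v) = (r v)%:E.
Proof.
rewrite lebesgue_measure_itvco; last exact: cumulative_mono.
congr EFin; rewrite /cumulative big_nat_recr//= pickleK_inv/=; lra.
Qed.

Lemma cell_unique v w u : cell v u -> cell w u -> v = w.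
Proof.
rewrite /cell /= !in_itv/= => /andP[uv vu] /andP[uw wu].
apply: (pcan_inj pickleK); apply/eqP; rewrite eqn_leq; apply/andP; split.
  rewrite leqNgt; apply/negP => /cumulative_mono vw.
  by have := lt_le_trans wu (le_trans vw uv); rewrite ltxx.
rewrite leqNgt; apply/negP => /cumulative_mono vw.
by have := lt_le_trans vu (le_trans vw uw); rewrite ltxx.
Qed.

Lemma measurable_quantile v : measurable [set u | quantile u = v].
Proof.
rewrite (_ : [set u | _] = cell v `|`
    ([set u : R | v = v0] `&` [set u | forall w, (~` cell w) u])).
  apply: measurableU; first exact: measurable_itv.
  apply: measurableI; first exact: (@measurable_Prop _ _ (v = v0)).
  by apply: measurable_forallC => w; apply: measurableC; exact: measurable_itv.
apply/seteqP; split=> u /=.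
  rewrite /quantile; case: xgetP => [w _ wu <-|nu <-]; first by left.
  by right.
move=> [vu|[-> nu]]; last exact: xgetPN.
by apply: xget_unique => // w wu; exact: cell_unique vu.
Qed.

Hypothesis r1 : (\esum_(v in [set: V]) (r v)%:E = (1 - c)%:E)%E.

Let rE : (\sum_(i <oo) (oapp r 0 (@pickle_inv V i))%:E = (1 - c)%:E)%E.
Proof.
rewrite -r1 esum_countType; last by move=> v _; rewrite lee_fin.
apply: eq_eseriesr => i _; case: pickle_inv => [v|]//=.
by rewrite mem_set.
Qed.

Lemma cumulative_le1 n : cumulative n <= 1.
Proof.
rewrite /cumulative -lerBrDl -lee_fin -rE -sumEFin.
by apply: nneseries_lim_ge => i _ _; rewrite lee_fin.
Qed.

Lemma quantile_fiber v : [set u | quantile u = v] `&` `[c, 1[ = cell v.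
Proof.
apply/seteqP; split=> u /=; rewrite in_itv/=; last first.
  move=> vu; split; first by apply: xget_unique => // w wu; exact: cell_unique vu.
  move: vu; rewrite /cell /= in_itv/= => /andP[vu uv].
  rewrite (lt_le_trans uv (cumulative_le1 _)) andbT; apply: le_trans vu.
  by apply: (le_trans _ (cumulative_mono (leq0n _))); rewrite /cumulative big_geq// addr0.
move=> [<- /andP[cu u1]].
have [n un] : exists n, u < cumulative n.
  apply: contrapT => /forallNP un; move: u1; rewrite ltNge => /negP; apply.
  rewrite -(lerD2r (- c)) -lee_fin -rE; apply: lime_le.
    by apply: is_cvg_nneseries => i _ _; rewrite lee_fin.
  apply: nearW => n; rewrite sumEFin lee_fin.
  by have /negP := un n; rewrite -leNgt /cumulative => h; rewrite lerBrDl.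
(* The first bound above [u] is not the initial one, which is c, and the code just before it stands
   for an element, otherwise the two bounds would coincide. *)
have [[|m] um min_m] := ex_minnP (ex_intro (fun n => u < cumulative n) n un).
  by move: um; rewrite /cumulative big_geq// addr0 ltNge cu.
have mu : cumulative m <= u.
  by rewrite leNgt; apply/negP => /min_m; rewrite ltnn.
have [w wm] : exists w : V, pickle w = m.
  have := @pickle_invK V m; rewrite /ocancel; case E : (pickle_inv m) => [w|]/=; first by exists w.
  move: um; rewrite /cumulative big_nat_recr//= E/= addr0 -/(cumulative m).
  by rewrite ltNge mu.
apply: (xgetI v0 (P := [set v | cell v u]) (x := w)).
by rewrite /= /cell /= in_itv/= wm mu um.
Qed.

End quantile.

(** Such a function factors through the last k letters, which take countably many values. *)
Lemma measurable_fun_agree (R : realType) (N : option nat) k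
    (f : past N -> R) : (forall x y, agree k x y -> f x = f y) ->
  measurable_fun setT f.
Proof.
move=> fk _ B mB; rewrite setTI.
rewrite (_ : _ @^-1` _ = [set x : past N | exists w,
    (size w = k /\ B (f (append point w))) /\ last_word k x = w]).
  apply: measurable_existsC => w; apply: measurableI.
    exact: (@measurable_Prop _ _ (size w = k /\ B (f (append point w)))).
  exact: measurable_last_word.
have fE (x : past N) : f (append point (last_word k x)) = f x.
  apply: fk => i ik; have sk : size (last_word k x) = k by rewrite size_mkseq.
  have := agree_last_word point x (last_word k x); rewrite sk => -[_ h].
  by rewrite h.
apply/seteqP; split=> x /=; last by move=> [w [[_ Bw] xw]]; rewrite -fE xw.
by move=> Bx; exists (last_word k x); rewrite fE size_mkseq.
Qed.

Section markov_update.
Context {R : realType} {N : option nat}.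
Local Notation A := (alphabet N).
Local Notation past := (past N).
Local Notation path_space := (path_space N).
Local Notation leb := (@lebesgue_measure R).
Local Notation F := (@Defs.F R N).
Variables (P : A -> past -> R) (I : past -> option nat -> A -> set R).
Hypothesis hP : is_kernel P.
Hypothesis hI : range_partitions P I.
Variable mu : probability path_space R.
Hypothesis hmu : compatible mu P.
Variable k : nat.
Implicit Types (x y : past) (a : A).

Lemma step_prob_driven : driven (F I) mu.
Proof.
move=> a B mB; rewrite hmu//; apply: eq_integral => y _.
by rewrite (step_prob_F hI).
Qed.

Definition past_mass x : R := fine (mu [set y | agree k (past_of y) x]).

Lemma past_massE x : (past_mass x)%:E = mu [set y | agree k (past_of y) x].
Proof.
rewrite fineK// fin_num_measure//.
exact: (measurable_preimage_past_of (measurable_agree _ _)).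
Qed.

(** The part of P(a | x) decided at levels at most k; what the k-step kernel has to add to it is
    [residual_mass]. *)
Definition letter_mass a x : R :=
  fine (leb (segment I x [set p | up_to_level k p /\ p.2 = a])).

Definition residual_mass a x : R := markov_kernel mu k a x - letter_mass a x.

(** On words that [mu] does not charge, [markov_kernel] is 0 and the residual masses may be
    negative, so a fixed letter is used. *)
Definition markov_update x (u : R) : A :=
  if u < level_mass I k x then F I x u
  else if past_mass x == 0 then point
  else quantile (point : A) (level_mass I k x) (residual_mass^~ x) u.

Lemma agree_sym n x y : agree n x y -> agree n y x.
Proof. by move=> xy i ik; rewrite xy. Qed.

Lemma agree_set x y : agree k x y ->
  (fun z : past => agree k z x) = (fun z => agree k z y).
Proof.
by move=> xy; apply/funext => z; apply/propext; split=> zx i ik; rewrite zx// xy.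
Qed.

Lemma markov_kernel_agree a x y : agree k x y ->
  markov_kernel mu k a x = markov_kernel mu k a y.
Proof.
move=> xy; rewrite /markov_kernel; have e z := congr1 (@^~ z) (agree_set xy).
by congr (fine (mu _) / fine (mu _)); apply/seteqP; split=> z /=; rewrite ?e -?e.
Qed.

Lemma past_mass_agree x y : agree k x y -> past_mass x = past_mass y.
Proof.
move=> xy; have e z := congr1 (@^~ z) (agree_set xy).
by congr (fine (mu _)); apply/seteqP; split=> z /=; rewrite ?e -?e.
Qed.

Lemma letter_mass_agree a x y : agree k x y -> letter_mass a x = letter_mass a y.
Proof.
by move=> xy; rewrite /letter_mass (segment_mass_agree hI xy)// => p [].
Qed.

Lemma markov_update_agree x y u : agree k x y -> markov_update x u = markov_update y u.
Proof.
move=> xy; rewrite /markov_update -(level_mass_agree hI xy) -(past_mass_agree xy).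
have -> : residual_mass^~ y = residual_mass^~ x.
  apply/funext => a; rewrite /residual_mass.
  by rewrite (markov_kernel_agree _ xy) (letter_mass_agree _ xy).
case: ifPn => // uk; have [u0|u0] := leP 0 u.
  by apply: (F_agree hI xy); rewrite u0.
by rewrite !(F_out hI)//= in_itv/= => /andP[]; rewrite leNgt u0.
Qed.

Lemma letter_massE a x : (letter_mass a x)%:E =
  leb (segment I x [set p | up_to_level k p /\ p.2 = a]).
Proof. by rewrite fineK// (segment_fin hI). Qed.

Lemma letter_mass_ge0 a x : 0 <= letter_mass a x.
Proof. by rewrite fine_ge0. Qed.

Lemma esum_letter_mass x :
  (\esum_(a in [set: A]) (letter_mass a x)%:E = (level_mass I k x)%:E)%E.
Proof.
rewrite fineK ?(segment_fin hI)//.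
rewrite (_ : segment I x _ = \bigcup_a segment I x [set p | up_to_level k p /\ p.2 = a]).
  rewrite measure_bigcup_countType; first by apply: eq_esum => a _; rewrite letter_massE.
    by move=> a _; exact: (measurable_segment hI).
  move=> a b _ _ [u [[p [_ <-] Ip] [q [_ <-] Iq]]].
  by rewrite (range_unique hI Ip Iq).
apply/seteqP; split=> u; first by move=> [p kp Iu]; exists p.2 => //; exists p.
by move=> [a _ [p [kp _] Iu]]; exists p.
Qed.

Lemma letter_mass_le a x : letter_mass a x <= P a x.
Proof.
rewrite -(step_prob_F hI) -lee_fin letter_massE step_probE; last exact: (measurable_F hI).
rewrite uniform_prob01E; last exact: (measurable_F hI).
apply: le_measure; rewrite ?inE//.
- exact: (measurable_segment hI).
- by apply: measurableI => //; exact: (measurable_F hI).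
rewrite (F_fiber01 hI) => u [[l b] [_ /= ->] Iu].
by exists l.
Qed.

Lemma measurable_letter_past a x :
  measurable [set y : path_space | y 0 = a /\ agree k (past_of y) x].
Proof.
apply: measurableI; first exact: measurable_path_coord.
exact: (measurable_preimage_past_of (measurable_agree _ _)).
Qed.

Lemma markov_kernelE a x : past_mass x != 0 ->
  (markov_kernel mu k a x)%:E =
  ((past_mass x)^-1%:E * mu [set y | y 0%R = a /\ agree k (past_of y) x])%E.
Proof.
move=> x0; rewrite /markov_kernel -/(past_mass x) mulrC EFinM fineK//.
by rewrite fin_num_measure//; exact: measurable_letter_past.
Qed.

(** [letter_mass a x] is at most P(a | y) for every y with the same last k letters. Integrating over
    these pasts, compatibility bounds [letter_mass a x * past_mass x] by the joint probability of
    the past word and [a]. *)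
Lemma residual_mass_ge0 a x : past_mass x != 0 -> 0 <= residual_mass a x.
Proof.
move=> x0; have xp : 0 < past_mass x by rewrite lt_neqAle eq_sym x0 fine_ge0.
rewrite subr_ge0 -lee_fin markov_kernelE// -(@lee_pmul2l _ (past_mass x)%:E)// ?lte_fin//.
rewrite [leRHS]muleA -[X in (X * mu _)%E]EFinM divff// mul1e past_massE muleC.
have mE : measurable (past_of @^-1` [set z : past | agree k z x] : set path_space).
  exact: (measurable_preimage_past_of (measurable_agree _ _)).
rewrite -integral_cst//.
apply: (@le_trans _ _ (\int[mu]_(y in past_of @^-1` [set z | agree k z x]) (P a (past_of y))%:E)%E).
  apply: ge0_le_integral => //.
  - by move=> y _; rewrite lee_fin letter_mass_ge0.
  - apply/measurable_funTS/measurable_EFinP.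
    have [mP _ _] := hP; exact: (measurableT_comp (mP a) measurable_past_of).
  - by move=> y yx; rewrite lee_fin -(letter_mass_agree _ yx) letter_mass_le.
by rewrite -hmu//; exact: measurable_agree.
Qed.

Lemma esum_markov_kernel x : past_mass x != 0 ->
  (\esum_(a in [set: A]) (markov_kernel mu k a x)%:E = 1)%E.
Proof.
move=> x0; transitivity (\esum_(a in [set: A]) ((past_mass x)^-1%:E *
    mu [set y | y 0%R = a /\ agree k (past_of y) x]))%E.
  by apply: eq_esum => a _; exact: markov_kernelE.
rewrite esum_countType; last by move=> a _; rewrite mule_ge0// lee_fin invr_ge0 fine_ge0.
transitivity (\sum_(n <oo) ((past_mass x)^-1%:E *
   oapp (fun a => if a \in [set: A] then mu [set y | y 0%R = a /\ agree k (past_of y) x] else 0)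
     0 (pickle_inv n)))%E.
  by apply: eq_eseriesr => n _; case: pickle_inv => [a|]/=; rewrite ?mem_set// mule0.
rewrite nneseriesZl; last first.
  by move=> n _; case: pickle_inv => [a|]//=; rewrite mem_set.
rewrite -(@esum_countType R A setT
  (fun a => mu [set y | y 0%R = a /\ agree k (past_of y) x])) -?measure_bigcup_countType//.
- transitivity ((past_mass x)^-1%:E * (past_mass x)%:E)%E; last by rewrite -EFinM mulVf.
  congr (_ * _)%E; rewrite past_massE; congr (mu _).
  by apply/seteqP; split=> y /=; [move=> [a _ []]|exists (y 0)].
- by move=> a _; exact: measurable_letter_past.
- by move=> a b _ _ [y [[<- _] [<- _]]].
Qed.

Lemma esum_residual_mass x : past_mass x != 0 ->
  (\esum_(a in [set: A]) (residual_mass a x)%:E = (1 - level_mass I k x)%:E)%E.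
Proof.
move=> x0; have := esum_markov_kernel x0.
rewrite (_ : (\esum_(a in [set: A]) _)%E = (\esum_(a in [set: A])
    ((residual_mass a x)%:E + (letter_mass a x)%:E))%E); last first.
  by apply: eq_esum => a _; rewrite -EFinD subrK.
rewrite esumD; last 2 first.
- by move=> a _; rewrite lee_fin residual_mass_ge0.
- by move=> a _; rewrite lee_fin letter_mass_ge0.
by rewrite esum_letter_mass EFinB => <-; rewrite addeK.
Qed.

Lemma measurable_markov_update x a : measurable [set u | markov_update x u = a].
Proof.
rewrite (_ : [set u | _] = ([set u | F I x u = a] `&` [set` `]-oo, level_mass I k x[]) `|`
  ([set u | (if past_mass x == 0 then point
     else quantile (point : A) (level_mass I k x) (residual_mass^~ x) u) = a] `&`
     [set` `[level_mass I k x, +oo[])).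
  apply: measurableU; apply: measurableI => //; first exact: (measurable_F hI).
  case: (boolP (past_mass x == 0)) => x0; first exact: (@measurable_Prop _ _ (point = a)).
  by apply: measurable_quantile => b; exact: residual_mass_ge0.
apply/seteqP; split=> u /=; rewrite !in_itv/= /markov_update andbT.
  by case: ltP => uk; [left|right].
by move=> [[Fa ->]//|[+ ku]]; rewrite ltNge ku.
Qed.

(** On [0, 1[ the letter [a] is produced by its intervals of level at most k and, beyond
    [level_mass], by its quantile cell; the two masses add up to the kernel. *)
Lemma step_prob_markov_update x a : past_mass x != 0 ->
  step_prob markov_update x a = markov_kernel mu k a x.
Proof.
move=> x0; rewrite /step_prob uniform_prob01E; last exact: measurable_markov_update.
have c0 := level_mass_ge0 I k x; have c1 := level_mass_le1 hI k x.
have r0 b := residual_mass_ge0 b x0.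
rewrite (_ : _ `&` _ = segment I x [set p | up_to_level k p /\ p.2 = a] `|`
    cell (level_mass I k x) (residual_mass^~ x) a).
  rewrite measureU; [|exact: (measurable_segment hI)|exact: measurable_itv|].
    transitivity (fine ((letter_mass a x)%:E + (residual_mass a x)%:E)); last first.
      by rewrite -EFinD/= addrC subrK.
    by congr (fine (_ + _)); [exact/esym/letter_massE|exact: lebesgue_measure_cell].
  rewrite -(quantile_fiber (point : A) r0 (esum_residual_mass x0)); apply/seteqP; split=> u //.
  move=> [[p [kp _] Iu] [_]]; rewrite /= in_itv/=.
  have : segment I x (up_to_level k) u by exists p.
  by rewrite (segment_level hI) /= in_itv/= ltNge => /andP[_ /negbTE ->].
rewrite -(quantile_fiber (point : A) r0 (esum_residual_mass x0)).
apply/seteqP; split=> u; rewrite /= !in_itv/=.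
  rewrite /markov_update (negbTE x0) => -[+ /andP[u0 u1]].
  case: ltP => uk Fa; last by right; rewrite u1.
  left; have : segment I x (up_to_level k) u.
    by rewrite (segment_level hI) /= in_itv/= u0.
  move=> [[l b] kp Iu]; exists (l, b) => //; split => //.
  by move: Fa; rewrite /Defs.F (range_indexE hI Iu).
rewrite /markov_update (negbTE x0) => -[[[l b] [kp /= <-] Iu]|[qa /andP[cu u1]]].
  have : segment I x (up_to_level k) u by exists (l, b).
  rewrite (segment_level hI) /= in_itv/= => /andP[u0 uk]; rewrite uk u0.
  by rewrite (lt_le_trans uk c1) /Defs.F (range_indexE hI (p := (l, b)) Iu).
by rewrite ltNge cu u1 (le_trans c0 cu).
Qed.

End markov_update.

(** * Coalescence and coupling *)

Section iid_blocks.
Context {R : realType}.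
Variable Q : probability (rseq R) R.
Hypothesis hQ : iid_law Q.
Variables (c : R) (K : nat).
Hypotheses (c0 : 0 < c) (c1 : c <= 1).
Local Notation B0 := (`[0, c[%classic : set R).

Let block b : seq int := [seq - (b * K + j)%N%:Z | j <- iota 0 K].

Let success b : set (rseq R) := box (block b) (fun=> B0).

Let failure M : set (rseq R) := [set u | forall b, (b < M)%N -> ~ success b u].

Let uniq_block b : uniq (block b).
Proof. by rewrite map_inj_uniq ?iota_uniq// => i j; lia. Qed.

Let measurable_success b : measurable (success b).
Proof. by apply: measurable_box => // n; exact: measurable_itv. Qed.

Let measurable_failure M : measurable (failure M).
Proof.
apply: measurable_forallC => b; apply: measurable_impl => _.
by apply: measurableC; exact: measurable_success.
Qed.

Let uniform_B0 : uniform_prob (@ltr01 R) B0 = c%:E.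
Proof.
rewrite uniform_prob01E; last exact: measurable_itv.
rewrite (_ : B0 `&` _ = B0); first by rewrite lebesgue_measure_itvco ?subr0// ltW.
apply/seteqP; split=> u /=; rewrite !in_itv/=; first by case.
by move=> /andP[u0 uc]; rewrite u0 uc (lt_le_trans uc c1).
Qed.

(** A box further in the past is carried along because success in block M is itself such a box: the
    induction hypothesis is applied both without and with it, and the two are subtracted. *)
Let Q_failure M s (B : int -> set R) : uniq s -> (forall n, measurable (B n)) ->
  (forall n, n \in s -> n <= - (M * K)%N%:Z) ->
  Q (failure M `&` box s B) = (((1 - c ^+ K) ^+ M)%:E * Q (box s B))%E.
Proof.
elim: M s B => [|M IH] s B us mB sM.
  by rewrite expr0 mul1e; congr (Q _); apply/seteqP; split=> [u []//|u].
(* A single family of factors for the joint box on block M and [s], whose times are disjoint. *)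
pose B' n := if n \in s then B n else B0.
have mB' n : measurable (B' n) by rewrite /B'; case: ifP.
have dis n : n \in s -> n \notin block M.
  move=> /sM ns; apply/negP => /mapP[j]; rewrite mem_iota => jK nE.
  move: ns; rewrite nE mulSn; lia.
have us' : uniq (block M ++ s).
  rewrite cat_uniq uniq_block us andbT/=; apply/hasPn => n /dis.
  by [].
have boxE : box (block M ++ s) B' = success M `&` box s B.
  apply/seteqP; split=> u.
    move=> Bu; split=> n ns.
      have := Bu n; rewrite mem_cat ns /B' => /(_ isT).
      by case: ifP => // /dis; rewrite ns.
    by have := Bu n; rewrite mem_cat ns orbT /B' ns => /(_ isT).
  move=> [Su Bu] n; rewrite mem_cat /B' => /orP[nb|ns]; last by rewrite ns; exact: Bu.
  by case: ifP => [/dis|_]; [rewrite nb|exact: Su].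
have QE : Q (box (block M ++ s) B') = ((c ^+ K)%:E * Q (box s B))%E.
  rewrite !hQ// big_cat/=; congr (_ * _)%E.
    rewrite (eq_big_seq (fun=> c%:E)); last first.
      move=> n nb; rewrite /B'; case: ifP => [/dis|_]; first by rewrite nb.
      exact: uniform_B0.
    rewrite big_map prodEFin; congr EFin.
    by rewrite -[in RHS](size_iota 0 K) big_const_seq count_predT iter_mulr_1.
  by apply: eq_big_seq => n ns; rewrite /B' ns.
have sM' n : n \in s -> n <= - (M * K)%N%:Z.
  by move=> /sM; rewrite mulSn; lia.
rewrite (_ : failure M.+1 `&` box s B =
    (failure M `&` box s B) `\` box (block M ++ s) B'); last first.
  rewrite boxE; apply/seteqP; split=> u.
    move=> [Fu Bu]; split; last by move=> [Su _]; exact: (Fu M).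
    by split=> // b bM; apply: Fu; exact: ltnW.
  move=> [[Fu Bu] nS]; split=> // b; rewrite ltnS leq_eqVlt => /predU1P[->|/Fu//].
  by move=> Su; apply: nS.
have mFs : measurable (failure M `&` box s B).
  by apply: measurableI; [exact: measurable_failure|exact: measurable_box].
rewrite measureD//; last 2 first.
- exact: measurable_box.
- by rewrite [ltLHS](_ : _ = Q (failure M `&` box s B))// -ge0_fin_numE// fin_num_measure.
have fQ : Q (box s B) = (fine (Q (box s B)))%:E.
  by rewrite fineK// fin_num_measure//; exact: measurable_box.
have e2 : Q ((failure M `&` box s B) `&` box (block M ++ s) B') =
   (((1 - c ^+ K) ^+ M)%:E * ((c ^+ K)%:E * Q (box s B)))%E.
  rewrite -QE -IH//; last first.
    move=> n; rewrite mem_cat => /orP[/mapP[j _ ->]|/sM'//]; lia.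
  congr (Q _); rewrite boxE; apply/seteqP; split=> u; last by move=> [Fu [Su Bu]]; do !split.
  by move=> [[Fu _] Su]; split.
transitivity (Q (failure M `&` box s B) -
  Q ((failure M `&` box s B) `&` box (block M ++ s) B'))%E; first by [].
rewrite e2 IH// fQ -!EFinM -EFinB; congr EFin; rewrite exprS.
by ring.
Qed.

(** The first M blocks all fail with probability (1 - c^K)^M, which tends to 0 because c is
    positive. *)
Lemma iid_law_block : measurable
    [set u : rseq R | exists b, forall j, (j < K)%N -> 0 <= u (- (b * K + j)%N%:Z) < c] /\
  Q [set u : rseq R | exists b, forall j, (j < K)%N -> 0 <= u (- (b * K + j)%N%:Z) < c] = 1%E.
Proof.
rewrite (_ : [set u | _] = [set u | exists b, success b u]); last first.
  apply/seteqP; split=> u /= [b ub]; exists b.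
    by move=> _ /mapP[j + ->]; rewrite mem_iota/= in_itv/= => jK; exact: ub.
  move=> j jK; have := ub (- (b * K + j)%N%:Z); rewrite /= in_itv/=; apply.
  by apply: map_f; rewrite mem_iota.
set C := [set u | _].
have mC : measurable C by apply: measurable_existsC => b; exact: measurable_success.
split=> //.
have q0 : 0 <= 1 - c ^+ K by rewrite subr_ge0 exprn_ile1// ltW.
have q1 : `|1 - c ^+ K| < 1 by rewrite ger0_norm// ltrBlDr ltrDl exprn_gt0.
have CM M : (Q (~` C) <= ((1 - c ^+ K) ^+ M)%:E)%E.
  apply: (@le_trans _ _ (Q (failure M `&` box [::] (fun=> setT)))).
    apply: le_measure; rewrite ?inE.
    - exact: measurableC.
    - by apply: measurableI; [exact: measurable_failure|exact: measurable_box].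
    - by move=> u nC; split=> // b _ Su; apply: nC; exists b.
  by rewrite Q_failure// hQ// big_nil mule1.
have mnC : measurable (~` C) by exact: measurableC.
have QnC : Q (~` C) = 0%E.
  apply/eqP; rewrite eq_le measure_ge0 andbT.
  have fQ : Q (~` C) = (fine (Q (~` C)))%:E by rewrite fineK// fin_num_measure.
  rewrite fQ lee_fin; apply: (cvgr_to_ge (cvg_expr q1)).
  by apply: nearW => M; have := CM M; rewrite fQ lee_fin.
have := @probability_setC _ _ _ Q _ mC; rewrite [X in X = _ -> _]QnC => h.
have fC : Q C = (fine (Q C))%:E by rewrite fineK// fin_num_measure.
by move: h; rewrite fC -EFinB => -[/eqP]; rewrite eq_sym subr_eq0 => /eqP <-.
Qed.

End iid_blocks.

(** * The two chains driven by the same uniform variables *)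

Section coupled_chains.
Context {R : realType} {N : option nat}.
Local Notation A := (alphabet N).
Local Notation past := (past N).
Local Notation path_space := (path_space N).
Local Notation F := (@Defs.F R N).
Local Notation L := (@Defs.L R N).
Variables (P : A -> past -> R) (I : past -> option nat -> A -> set R).
Hypothesis hP : is_kernel P.
Hypothesis hI : range_partitions P I.
Variable mu : probability path_space R.
Hypothesis smu : stationary mu.
Hypothesis hmu : compatible mu P.
Variable k : nat.
Local Notation G := (markov_update I mu k).

(** The common marginal is given at times 1, ..., k; stationarity and a shift by k + 1 bring it to
    times -k, ..., -1. *)
Lemma approx_last_word (nu : probability path_space R) w :
  canonical_markov_approx mu k nu ->
  nu [set y | last_word k (past_of y) = w] = mu [set y | last_word k (past_of y) = w].
Proof.
move=> [snu _ munu]; have [sw|sw] := eqVneq (size w) k; last first.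
  rewrite (_ : [set y | _] = set0) ?measure0//; apply/seteqP; split=> y //= yw.
  by move: sw; rewrite -yw size_mkseq eqxx.
have mB : measurable (past_of @^-1` [set x : past | last_word k x = w] : set path_space).
  exact: (measurable_preimage_past_of (measurable_last_word _ _)).
have e : iter k.+1 (@Defs.shift N) @^-1` (past_of @^-1` [set x | last_word k x = w]) =
    [set y : path_space | forall i, (i < k)%N -> y i.+1%:Z = nth point w i].
  apply/seteqP; split=> y.
    move=> yw i ik; have := congr1 (fun v => nth point v i) yw.
    by rewrite nth_mkseq// /past_of iter_shift => <-; congr (y _); lia.
  move=> yw; apply: (@eq_from_nth _ point) => [|i]; rewrite size_mkseq// => ik.
  by rewrite nth_mkseq// /past_of iter_shift -yw//; congr (y _); lia.
transitivity (nu (iter k.+1 (@Defs.shift N) @^-1` (past_of @^-1` [set x | last_word k x = w]))).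
  exact/esym/stationary_iter.
by rewrite e munu -e; exact: stationary_iter.
Qed.

Lemma past_mass_last_word w : size w = k ->
  (past_mass mu k (append point w))%:E = mu [set y | last_word k (past_of y) = w].
Proof.
move=> <-; rewrite past_massE; congr (mu _).
by apply/seteqP; split=> y /=; have [] := agree_last_word point (past_of y) w.
Qed.

(** The words of length k that [mu] does not charge are countably many, and [nu] gives each of them
    the same mass 0. *)
Lemma ae_past_mass (nu : probability path_space R) :
  canonical_markov_approx mu k nu ->
  {ae nu, forall y, past_mass mu k (past_of y) != 0}.
Proof.
move=> hnu.
pose D := [set w : seq A | size w = k /\ past_mass mu k (append point w) = 0].
have mD w : measurable [set y : path_space | last_word k (past_of y) = w].
  exact: (measurable_preimage_past_of (measurable_last_word _ _)).
exists (\bigcup_(w in D) [set y | last_word k (past_of y) = w]); split.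
- rewrite (_ : \bigcup_(w in _) _ = [set y | exists w, D w /\ last_word k (past_of y) = w]).
    apply: measurable_existsC => w; apply: measurableI; last exact: mD.
    exact: (@measurable_Prop _ _ (D w)).
  by apply/seteqP; split=> y /=; [move=> [w]; exists w|move=> [w []]; exists w].
- rewrite measure_bigcup_countType//; last by move=> v w _ _ [y [/= -> ->]].
  apply: esum1 => w [sw w0]; transitivity (mu [set y | last_word k (past_of y) = w]).
    exact: approx_last_word.
  by rewrite -past_mass_last_word// w0.
- move=> y /= /negP; rewrite negbK => /eqP y0; exists (last_word k (past_of y)) => //=.
  split; first by rewrite size_mkseq.
  rewrite -y0; apply: past_mass_agree; apply: agree_sym.
  have := agree_last_word point (past_of y) (last_word k (past_of y)).
  by rewrite size_mkseq => -[_]; exact.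
Qed.

Lemma measurable_step_update a : measurable_fun setT (fun x : past => step_prob G x a).
Proof.
apply: (@measurable_fun_agree _ _ k) => x y xy; rewrite /step_prob; congr (fine (_ _)).
by apply/seteqP; split=> u /=; rewrite (markov_update_agree hI _ _ xy).
Qed.

Lemma markov_update_driven (nu : probability path_space R) :
  canonical_markov_approx mu k nu -> driven G nu.
Proof.
move=> hnu a B mB; have [_ cnu _] := hnu; rewrite cnu//.
have mPB := measurable_preimage_past_of mB.
apply: ge0_ae_eq_integral => //.
- apply/measurable_funTS/measurable_EFinP.
  have mk : measurable_fun setT (markov_kernel mu k a).
    by apply: (@measurable_fun_agree _ _ k) => x y; exact: markov_kernel_agree.
  exact: (measurableT_comp mk measurable_past_of).
- apply/measurable_funTS/measurable_EFinP.
  exact: (measurableT_comp (measurable_step_update a) measurable_past_of).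
- by move=> y _; rewrite lee_fin divr_ge0// fine_ge0.
- move=> y _; rewrite lee_fin; apply: step_prob_ge0 => x b.
  exact: (measurable_markov_update hP hI hmu).
- apply: filterS (ae_past_mass hnu) => y y0 _.
  by rewrite (step_prob_markov_update hP hI hmu).
Qed.

Lemma word_local (H : past -> R -> A) m n x y u :
  (forall i, (i < n)%N -> forall x y, H x (u (m + i%:Z)) = H y (u (m + i%:Z))) ->
  word H m n x u = word H m n y u.
Proof.
elim: n => //= n IH Hu; rewrite IH => [|i ni]; last exact/Hu/ltnW.
by congr rcons; exact: Hu.
Qed.

Lemma word_agree (H : past -> R -> A) m n x y u :
  (forall x y v, agree k x y -> H x v = H y v) ->
  agree k x y -> word H m n x u = word H m n y u.
Proof.
move=> Hk xy; elim: n => //= n ->; congr rcons; apply: Hk.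
by apply: agreeW (agree_append xy); rewrite leq_addl.
Qed.

(** The length of the level 0 region is the same for all pasts, so the k + 1 letters of the block do
    not depend on the past; afterwards the update reads only the last k letters. *)
Lemma update_coalesces u b :
  (forall j, (j < k.+1)%N -> 0 <= u (- (b * k.+1 + j)%N%:Z) < level_mass I 0 point) ->
  coalesces G u.
Proof.
move=> ub; exists (b * k.+1 + k)%N; exists (current G (b * k.+1 + k).+1 point u) => x.
rewrite /current; set m : int := 1 - _; rewrite -addnS addnC !word_add.
have -> : word G m k.+1 x u = word G m k.+1 point u.
  apply: word_local => i ik y z.
  have := ub (k - i)%N; rewrite ltnS leq_subr => /(_ isT).
  have -> : - (b * k.+1 + (k - i))%N%:Z = m + i%:Z by rewrite /m; lia.
  move=> u0; rewrite /markov_update.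
  have uk z' : u (m + i%:Z) < level_mass I k z'.
    have /andP[_ h] := u0; apply: (lt_le_trans h).
    by rewrite -(level_mass_agree hI (x := z')) ?(level_mass_mono hI)// => ?.
  rewrite !uk; apply: (F_agree hI (k := 0)) => //.
  by rewrite (level_mass_agree hI (y := point)).
congr (last _ (_ ++ _)); apply: word_agree.
  by move=> y z v yz; exact: (markov_update_agree hI _ _ yz).
apply: (agreeW (l := size (word G m k.+1 point u))); first by rewrite size_word leqnSn.
exact: agree_appendT.
Qed.

(* -l belongs to Theta'[0]: by cutoff_word_F it suffices to test one past. *)
Definition cutoff (u : rseq R) (l : nat) := forall n, (n <= l)%N ->
  0 <= u (- l%:Z + n%:Z) < level_mass I n (append point (word (F I) (- l%:Z) n point u)).

(** After n letters any two starting pasts agree on n positions, and [cutoff] puts the next variable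
    at level at most n, where [H] is assumed to act as [F]. A general [H] serves both [F] and the
    Markov update. *)
Lemma cutoff_word (H : past -> R -> A) u l : cutoff u l ->
  (forall n x y v, (n <= l)%N -> agree n x y -> 0 <= v < level_mass I n y ->
     H x v = F I y v) ->
  forall x, word H (- l%:Z) l.+1 x u = word (F I) (- l%:Z) l.+1 point u.
Proof.
move=> ul HF x; have : (l.+1 <= l.+1)%N by [].
elim: {1 3 4}l.+1 => //= n IH nl; rewrite IH; last exact: ltnW.
congr rcons; apply: (HF n) => //; last exact: ul.
have := @agree_appendT N x point (word (F I) (- l%:Z) n point u).
by rewrite size_word.
Qed.

Lemma cutoff_word_F u l x : cutoff u l ->
  word (F I) (- l%:Z) l.+1 x u = word (F I) (- l%:Z) l.+1 point u.
Proof.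
move=> ul; apply: cutoff_word => // n y z v _ yz vn; apply: (F_agree hI yz).
by rewrite (level_mass_agree hI yz).
Qed.

(** The levels met are at most l, hence at most k, and there the update takes its [F] branch. *)
Lemma cutoff_word_update u l x : (l <= k)%N -> cutoff u l ->
  word G (- l%:Z) l.+1 x u = word (F I) (- l%:Z) l.+1 point u.
Proof.
move=> lk ul; apply: cutoff_word => // n y z v nl yz vn.
have vy : 0 <= v < level_mass I n y by rewrite (level_mass_agree hI yz).
rewrite /markov_update ifT; first exact: (F_agree hI yz).
have /andP[_ h] := vy; apply: (lt_le_trans h); apply: (level_mass_mono hI).
exact: leq_trans nl lk.
Qed.

Lemma currentS (H : past -> R -> A) l x u :
  current H l.+1 x u = last point (word H (- l%:Z) l.+1 x u).
Proof. by rewrite /current; have -> : 1 - l.+1%:Z = - l%:Z by lia. Qed.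

Lemma cutoff_coalesces u l : cutoff u l -> coalesces (F I) u.
Proof.
move=> ul; exists l, (last point (word (F I) (- l%:Z) l.+1 point u)) => x.
by rewrite currentS (cutoff_word_F x ul).
Qed.

(** Both recursions produce the same word on the times -l, ..., 0 from every past, and both limits
    are its last letter. *)
Lemma cutoff_limit_letter u l : (l <= k)%N -> cutoff u l ->
  limit_letter (F I) u = limit_letter G u.
Proof.
move=> lk ul; set a := last point (word (F I) (- l%:Z) l.+1 point u).
transitivity a.
  apply: (@limit_letterE _ _ _ l.+1) => l' ll'; apply: (@current_stable _ _ _ l) => // x.
  by rewrite currentS (cutoff_word_F x ul).
apply/esym/(@limit_letterE _ _ _ l.+1) => l' ll'; apply: (@current_stable _ _ _ l) => // x.
by rewrite currentS (cutoff_word_update x lk ul).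
Qed.

Lemma measurable_cutoff l : measurable [set u | cutoff u l].
Proof.
apply: measurable_forallC => n; apply: measurable_impl => _.
rewrite (_ : [set u | _] = [set u : rseq R | exists w, word (F I) (- l%:Z) n point u = w /\
    (`[0, level_mass I n (append point w)[%classic : set R) (u (- l%:Z + n%:Z))]).
  apply: measurable_existsC => w; apply: measurableI.
    by apply: measurable_word => x a; exact: (measurable_F hI).
  by apply: measurable_coord; exact: measurable_itv.
apply/seteqP; split=> u /=.
  by move=> ?; exists (word (F I) (- l%:Z) n point u); rewrite /= in_itv.
by move=> [w [-> ]]; rewrite in_itv.
Qed.

Lemma F_lenE m n x (u : rseq R) : F_len I m n x u = word (F I) m n x u.
Proof. by elim: n => //= n ->. Qed.

Lemma Theta'_cutoff (u : rseq R) i : Theta' I u i -> i <= 0 /\ cutoff u (absz i).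
Proof.
move=> [i0 iL]; split=> // n ni; have -> : - (absz i)%:Z = i by lia.
have := iL point (i + n%:Z); have -> : i <= i + n%:Z <= 0 by lia.
have -> : i + n%:Z - i = n%:Z by lia.
move=> /(_ isT) /(level_leP hI); rewrite /F_str F_lenE.
(* At the starting time the string F_{i,i-1} is empty, which [F_str] handles as a separate case. *)
case: n ni => [|n] ni; first by rewrite ifF//; lia.
rewrite ifT; last by lia.
by have -> : absz (i + n.+1%:Z - 1 - i + 1)%R = n.+1 by lia.
Qed.

End coupled_chains.

Unset Implicit Arguments.

Theorem theorem4p3 (R : realType) (N : option nat) (hN : N <> Some 0%N)
    (P : alphabet N -> past N -> R) (hP : is_kernel P)
    (hnn : weakly_non_null P)
    (I : past N -> option nat -> alphabet N -> set R)
    (hI : range_partitions P I)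
    (d : measure_display) (Omega : measurableType d) (Pr : probability Omega R)
    (U : int -> {RV Pr >-> R}) (hU : iid_uniform U)
    (hTheta : {ae Pr, forall w, Theta' I (fun n => U n w) !=set0})
    (mu : probability (path_space N) R) (hmu : stationary mu)
    (hmuP : compatible mu P)
    (theta : Omega -> int)
    (mtheta : forall n : int, measurable [set w | theta w = n])
    (htheta : {ae Pr, forall w, Theta' I (fun n => U n w) (theta w)})
    (k : nat) (nu : probability (path_space N) R)
    (hnu : canonical_markov_approx mu k nu) :
  (dbar mu nu <= Pr [set w | (theta w < - k%:Z)%R])%E.
Proof.
have [mU [Q hQ QE]] := iid_uniform_law hU.
pose G := markov_update I mu k.
have mF x a := measurable_F hI x a.
have mG x a : measurable [set u | G x u = a] by exact: (measurable_markov_update hP hI hmuP).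
(* A measurable substitute for the nonemptiness of [Theta']; it has full probability because almost
   every [theta w] provides a cutoff. *)
pose C := [set u : rseq R | exists l, cutoff I u l].
have mC : measurable C.
  by apply: measurable_existsC => l; exact: (measurable_cutoff hI).
have mUE (E : set (rseq R)) : measurable E -> measurable [set w : Omega | E (fun n => U n w)].
  by move=> mE; rewrite -[X in measurable X]setTI; exact: mU.
have QC : Q C = 1%E.
  have nC : Pr [set w | (~` C) (fun n => U n w)] = 0%E.
    apply/negligibleP; first exact: mUE (measurableC mC).
    apply: negligibleS htheta => w nCw /= /(Theta'_cutoff hI)[_ Cw].
    by apply: nCw; exists (absz (theta w)).
  have := @probability_setC _ _ _ Q _ (measurableC mC).
  by rewrite setCK => ->; rewrite [X in (_ - X)%E]QE nC sube0.
(* At n = 0 a single cutoff already places a nonnegative number below the level 0 mass, which is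
   therefore positive. *)
have [u0 [l0 /(_ 0%N isT) /andP[c1 c2]]] : C !=set0.
  apply/set0P/negP => /eqP C0; move: QC; rewrite C0 measure0 => /eqP.
  by rewrite eq_sym onee_eq0.
have c0 : 0 < level_mass I 0 (point : past N).
  apply: (le_lt_trans c1); apply: (lt_le_trans c2).
  by rewrite (level_mass_agree hI (y := point)).
have aeF : {ae Q, forall u, forall t, coalesces (Defs.F I) (translate t u)}.
  by apply: (ae_coalesces hQ mC QC) => u [l]; exact: (cutoff_coalesces hI).
have [mK QK] := iid_law_block hQ k.+1 c0 (level_mass_le1 hI 0 point).
have aeG : {ae Q, forall u, forall t, coalesces G (translate t u)}.
  by apply: (ae_coalesces hQ mK QK) => u [b]; exact: (update_coalesces hI).
have muE : forall B, measurable B -> mu B = Q (limit_path (Defs.F I) @^-1` B).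
  apply: (cftp_law mF hQ _ hmu _ aeF) => [a|]; last exact: (step_prob_driven hI hmuP).
  have -> : (fun x => step_prob (Defs.F I) x a) = P a.
    by apply/funext => x; exact: (step_prob_F hI).
  by have [mP _ _] := hP; exact: mP.
have nuE : forall B, measurable B -> nu B = Q (limit_path G @^-1` B).
  have [snu _ _] := hnu.
  apply: (cftp_law mG hQ _ snu _ aeG) => [a|]; first exact: (measurable_step_update hI).
  exact: (markov_update_driven hP hI hmu hmuP hnu).
pose h (u : rseq R) : path_space N * path_space N := (limit_path (Defs.F I) u, limit_path G u).
have mh : measurable_fun setT h.
  by apply: measurable_fun_pair; exact: measurable_limit_path.
have [g gE] := pushforward_probability Q mh.
pose E := [set p : path_space N * path_space N | p.1 0 <> p.2 0].
apply: (@le_trans _ _ (g E)).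
  apply: ereal_inf_lbound; exists g; split=> //; split=> B mB; rewrite !gE.
  - exact/esym/muE.
  - exact/esym/nuE.
  - have mhB : measurable (h @^-1` B).
      by rewrite -[X in measurable X]setTI; exact: mh.
    rewrite -[RHS](iid_law_translate 1 hQ mhB); congr (Q _).
    have e u : h (translate 1 u) = (Defs.shift (h u).1, Defs.shift (h u).2).
      by rewrite /h; congr pair; apply/funext => t; rewrite limit_path_translate.
    by apply/seteqP; split=> u; rewrite /preimage /= ?e // -e.
have mE : measurable (h @^-1` E).
  rewrite (_ : h @^-1` E =
      [set u | exists a, ~ (limit_path G u 0 = a) /\ limit_path (Defs.F I) u 0 = a]).
    apply: measurable_existsC => a; apply: measurableI.
      apply: measurableC; rewrite -[X in measurable X]setTI.
      exact: (measurable_limit_path mG measurableT (measurable_path_coord 0 a)).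
    rewrite -[X in measurable X]setTI.
    exact: (measurable_limit_path mF measurableT (measurable_path_coord 0 a)).
  apply/seteqP; split=> u; rewrite /preimage /E /h /=.
    by move=> FG; exists (limit_path (Defs.F I) u 0); split=> // e; exact/FG/esym.
  by move=> [a [Ga Fa]] FG; apply: Ga; rewrite -FG.
rewrite gE QE.
have mB : measurable [set w | (theta w < - k%:Z)%R].
  rewrite (_ : [set w | _] = [set w | exists n : int, (n < - k%:Z) /\ theta w = n]).
    apply: measurable_existsC => n; apply: measurableI; last exact: mtheta.
    exact: (@measurable_Prop _ _ (is_true (n < - k%:Z))).
  by apply/seteqP; split=> w /=; [exists (theta w)|move=> [n [+ ->]]].
(* [Z] is a null set containing the samples where [theta] leaves [Theta']; adjoining it to the
   bounding event costs nothing. *)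
have [Z [mZ PZ Zsub]] := htheta.
rewrite -(measureU0 mB mZ PZ); apply: le_measure; rewrite ?inE.
- exact: mUE.
- exact: measurableU.
move=> w /= Ew; have [wk|wk] := ltP (theta w) (- k%:Z); first by left.
(* By contradiction: off [Z], an index at least -k is a cutoff at distance at most k, and the two
   letters at time 0 would coincide. *)
right; apply: Zsub => /= /(Theta'_cutoff hI)[t0 tw]; apply: Ew.
have lk : (absz (theta w) <= k)%N by lia.
have translate0 (u : rseq R) : translate 0 u = u.
  by apply/funext => n; rewrite /translate addr0.
rewrite /h/= /limit_path !translate0.
exact: (cutoff_limit_letter hI _ lk tw).
Qed.
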